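(* There exists an absolute constant $C>0$ such that the following holds. Let $X=(X_1,\ldots,X_n)$ be a random vector whose coordinates $X_i$ are real-valued independent random variables. Let $t,p\ge 0$ be such that $$\mathcal{L}(X_i,t)\le p\quad\text{for all } i=1,\ldots,n.$$ Let $P$ be an orthogonal projection in $\mathbb{R}^n$ onto a $d$-dimensional subspace. Then $$\mathcal{L}(PX,\,t\sqrt{d})\le (Cp)^d.$$
   Context: For a random vector $Z$ taking values in $\mathbb{R}^k$, the concentration function is $\mathcal{L}(Z,t)=\max_{u\in\mathbb{R}^k}\mathbb{P}\{\|Z-u\|_2\le t\}$ for $t\ge 0$, where $\|\cdot\|_2$ is the Euclidean norm (for real-valued $X_i$, $k=1$). An absolute constant does not depend on any of the parameters. *)

(* Defs.v *)
From HB Require Import structures.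
From mathcomp Require Import all_boot all_order all_algebra.
From mathcomp Require Import all_classical all_reals all_analysis.

Set Implicit Arguments.
Unset Strict Implicit.
Unset Printing Implicit Defensive.

Import Order.TTheory GRing.Theory Num.Theory.

Local Open Scope classical_set_scope.
Local Open Scope ring_scope.

Definition dotv (R : realType) (n : nat) (x y : 'cV[R]_n) : R :=
  \sum_(i < n) x i 0 * y i 0.

(* The library norm [`|x|] on matrices is the sup norm, hence this one. *)
Definition norm2 (R : realType) (n : nat) (x : 'cV[R]_n) : R :=
  Num.sqrt (dotv x x).

(* The maximum over u is written as a supremum in the extended reals, so that
   the definition does not presuppose that it is attained. *)
Definition concentration (d : measure_display) (T : measurableType d)
    (R : realType) (Pr : probability T R) (k : nat) (Z : T -> 'cV[R]_k)
    (t : R) : \bar R :=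
  ereal_sup [set Pr [set w | norm2 (Z w - u) <= t] | u in [set: 'cV[R]_k]].

Definition mutually_independent (d : measure_display) (T : measurableType d)
    (R : realType) (Pr : probability T R) (n : nat)
    (X : 'I_n -> {RV Pr >-> R}) : Prop :=
  forall (J : {set 'I_n}) (A : 'I_n -> set R),
    (forall i, i \in J -> measurable (A i)) ->
    Pr [set w | forall i, i \in J -> A i (X i w)] =
    (\prod_(i in J) Pr (X i @^-1` A i))%E.

Definition is_orthogonal_projection (R : realType) (n : nat) (P : 'M[R]_n)
    (E : {vspace 'cV[R]_n}) : Prop :=
  forall x : 'cV[R]_n,
    P *m x \in E /\ (forall y, y \in E -> dotv (x - P *m x) y = 0).

(* Main.v *)
(* After discretising, each coordinate takes finitely many values and it suffices to bound
   M(P) = sup_v E exp (- |P (X - v)|^2 / 2) for coordinates with unit-ball mass at most p.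
   If P_kk > 1/4 for some k, integrating over X_k alone costs a factor C p and leaves the
   projection onto the part of the range of P orthogonal to P e_k, so one inducts on the rank.
   If all P_kk <= 1/4, write P = U^T U with U U^T = 1 and columns u_i of square norm c_i.
   Fourier inversion bounds M(P) by a Gaussian integral over R^d of the product of the
   |phi_i(<x, u_i>)|.  The weights det(U_g)^2 / d! on the d-tuples g of columns form a probability
   with intensities c_i; AM-GM against it dominates the integrand by an average of products
   of d factors, each a power 1 / c_i of a one-dimensional function of <x, u_i>.  A linear change of
   variables splits these into one-dimensional integrals, each O(p sqrt(c_i)): there
   D = 1 - |phi|^2 satisfies D(2 s) <= 4 D(s), so dilating by 2 while halving r = 1 / sqrt(c_i)
   reduces large r to r <= 2.  Cauchy-Schwarz and sum_g prod_j c_(g j) = d^d <= d! e^d conclude. *)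

From HB Require Import structures.
Require Import Defs.
From mathcomp Require Import all_boot all_order all_algebra all_fingroup.
From mathcomp Require Import all_classical all_reals all_analysis.
From mathcomp Require Import measurable_realfun ring lra complex.

Set Implicit Arguments.
Unset Strict Implicit.
Unset Printing Implicit Defensive.

Import Order.TTheory GRing.Theory Num.Theory.
Import numFieldNormedType.Exports.

Local Open Scope classical_set_scope.
Local Open Scope ring_scope.

(** * Gaussian integrals on the line *)

Section gauss.
Context {R : realType}.
Notation mu := (@lebesgue_measure R).
Implicit Types s x z : R.

(** The difficulty is to lose only factors of the form C^d. The threshold 1/4 comes from the
    exponent 1 / c_i of |phi_i|: with a Gaussian weight, Plancherel bounds the integral of |phi|^2
    by O(p), whereas |phi| alone, which c_i near 1 would leave, admits no such bound (uniform laws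
    cost a logarithm). For c_i <= 1/4 the exponent is at least 4: two powers pay for Plancherel, and
    the rest give the decay that produces sqrt(c_i). This factor is essential: the Jacobian cancels
    only one of the two powers of the determinant in the weight of g, and the other must still be
    summed over g. The determinantal weights thus play the part of a geometric Brascamp-Lieb
    inequality, up to a factor e^d. The final constant is [expR 8 * core_const]: apart from the
    tails, the event forces the discretised |P (X - v)|^2 to be at most 16 d, so Markov's inequality
    for exp (- |.|^2 / 2) costs exp (8 d). The tail error [n%:R * e] and the excess over [p] vanish
    as [e] tends to 0 with [n] fixed. *)

Lemma continuous_measurableT (D : set R) (f : R -> R) :
  continuous f -> measurable_fun D f.
Proof. by move=> cf; apply: measurable_funTS; exact: continuous_measurable_fun. Qed.

Definition gauss s x : R := expR (- (x ^+ 2 / (s ^+ 2 *+ 2))).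
Notation gw := (gauss 1).

Lemma gauss_ge0 s x : 0 <= gauss s x. Proof. exact: expR_ge0. Qed.

Lemma gwE x : gw x = expR (- (x ^+ 2 / 2)).
Proof. by rewrite /gauss expr1n. Qed.

Lemma gaussN s x : gauss s (- x) = gauss s x.
Proof. by rewrite /gauss sqrrN. Qed.

Lemma is_derive_gw x : is_derive x 1 (gw : R -> R) (- x * gw x).
Proof.
have -> : gw = expR \o (fun x => - (2^-1 * x ^+ 2)).
  by apply/funext => y /=; rewrite gwE mulrC.
apply: is_derive_eq; rewrite /= ?scaler1 ?scaler0 ?addr0 /GRing.scale/=.
have -> : 2^-1 * (x + x) = x by lra.
by rewrite mulrC.
Qed.

Lemma continuous_gauss s : continuous (gauss s).
Proof.
move=> x; apply: continuous_comp; last exact: continuous_expR.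
apply: (@continuousN _ R^o); apply: continuousM; last exact: cst_continuous.
exact: exprn_continuous.
Qed.

Lemma integral_gauss s : 0 < s ->
  (\int[mu]_x (gauss s x)%:E = (s * Num.sqrt (pi *+ 2))%:E)%E.
Proof.
move=> s0; have := @integral_normal_pdf R 0 s.
rewrite (normal_pdfE _ (lt0r_neq0 s0)).
have p0 := normal_peak_gt0 (lt0r_neq0 s0).
under eq_integral do rewrite /normal_fun subr0 mulNr EFinM.
rewrite ge0_integralZl//=; last 2 first.
- apply/measurable_EFinP; apply: continuous_measurableT; exact: continuous_gauss.
- by rewrite lee_fin ltW.
move/(congr1 (fun u => (normal_peak s)^-1%:E * u)%E).
rewrite muleA -EFinM mulVf ?gt_eqF// mul1e mule1 => ->.
by rewrite /normal_peak invrK -mulrnAr sqrtrM ?sqr_ge0// sqrtr_sqr gtr0_norm.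
Qed.

Lemma integrable_gauss s : 0 < s -> mu.-integrable setT (EFin \o gauss s).
Proof.
move=> s0; apply/integrableP; split.
  by apply/measurable_EFinP; apply: continuous_measurableT; exact: continuous_gauss.
under eq_integral do rewrite /= ger0_norm ?gauss_ge0//.
by rewrite integral_gauss// ltry.
Qed.

Lemma integrable_dom s c (f : R -> R) : 0 < s -> continuous f ->
  (forall x, `|f x| <= c * gauss s x) -> mu.-integrable setT (EFin \o f).
Proof.
move=> s0 cf fg.
apply: (@le_integrable _ _ _ mu _ measurableT _ (fun x => c%:E * (gauss s x)%:E)%E).
- by apply/measurable_EFinP; apply: continuous_measurableT.
- move=> x _; rewrite /= lee_fin [leRHS]ger0_norm//; exact: le_trans (fg x).
- by apply: integrableZl => //; exact: integrable_gauss.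
Qed.

(** Provides the integrable majorant for differentiating cos (z x) gw x in z under the integral
    sign. It reduces to |x| <= 1 + 3 x^2 / 8 <= exp (3 x^2 / 8). *)
Lemma norm_mul_gw x : `|x| * gw x <= gauss 2 x.
Proof.
have -> : gw x = gauss 2 x * expR (- (3 * x ^+ 2 / 8)).
  by rewrite gwE /gauss -expRD; congr expR; field.
rewrite mulrCA ler_piMr ?gauss_ge0// expRN -(ler_pM2r (expR_gt0 (3 * x ^+ 2 / 8))).
rewrite mulfVK ?gt_eqF ?expR_gt0// mul1r.
apply: le_trans (expR_ge1Dx _); rewrite -real_normK ?num_real//.
have := sqr_ge0 (3 * `|x| - 4); have := normr_ge0 x; nra.
Qed.

Lemma continuous_cosM z : continuous (fun x => cos (z * x)).
Proof.
move=> x; apply: continuous_comp; last exact: continuous_cos.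
exact: mulrl_continuous.
Qed.

Lemma continuous_sinM z : continuous (fun x => sin (z * x)).
Proof.
move=> x; apply: continuous_comp; last exact: continuous_sin.
exact: mulrl_continuous.
Qed.

Lemma gw_nat_cvg0 (F : R -> R) c : (forall x, `|F x| <= c * gw x) ->
  (F n%:R @[n --> \oo] --> 0) /\ (F (- n%:R) @[n --> \oo] --> 0).
Proof.
move=> Fb; have c0 : 0 <= c.
  have := le_trans (normr_ge0 _) (Fb 0); rewrite pmulr_lge0 ?expR_gt0//.
have gwb n : gw n%:R <= 2 * harmonic n.
  rewrite gwE expRN /harmonic /= -(ler_pM2r (expR_gt0 (n%:R ^+ 2 / 2))).
  rewrite mulVf ?gt_eqF ?expR_gt0//.
  rewrite mulrAC ler_pdivlMr ?ltr0n// mul1r -natr1.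
  apply: (@le_trans _ _ (2 * (1 + n%:R ^+ 2 / 2))).
    by have := sqr_ge0 (n%:R - 1 : R); nra.
  by rewrite ler_pM2l// expR_ge1Dx.
have h0 : c * (2 * harmonic n) @[n --> \oo] --> (0 : R).
  rewrite -[X in _ --> X](mulr0 c); apply: cvgM; first exact: cvg_cst.
  rewrite -[X in _ --> X](mulr0 2); apply: cvgM; [exact: cvg_cst|exact: cvg_harmonic].
split; apply: (squeeze_cvgr (f := fun n => - (c * (2 * harmonic n))) (h := fun n => c * (2 * harmonic n))) => //.
- apply: nearW => n; rewrite -ler_norml; apply: le_trans (Fb _) _.
  by rewrite ler_wpM2l.
- by rewrite -oppr0; apply: cvgN.
- apply: nearW => n; rewrite -ler_norml; apply: le_trans (Fb _) _.
  by rewrite gaussN ler_wpM2l.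
- by rewrite -oppr0; apply: cvgN.
Qed.

(** The fundamental theorem on [-n, n] leaves boundary values that the Gaussian bound sends to 0,
    while dominated convergence identifies the limit of the integrals. It serves as integration by
    parts on the whole line. *)
Lemma Rintegral_derive_eq0 (F f : R -> R) c :
  (forall x : R, is_derive x 1 F (f x)) -> continuous f ->
  mu.-integrable setT (EFin \o f) -> (forall x, `|F x| <= c * gw x) ->
  \int[mu]_x f x = 0.
Proof.
move=> dF cf intf Fb; have [Fp Fn] := gw_nat_cvg0 Fb.
have cF : continuous F.
  by move=> x; apply/differentiable_continuous/derivable1_diffP; exact: ex_derive.
pose I n := `[- n%:R, n%:R]%classic : set R.
have E n : (0 < n)%N -> \int[mu]_(x in I n) f x = F n%:R - F (- n%:R).
  move=> n0; rewrite /Rintegral (@continuous_FTC2 _ f F)//.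
  - by rewrite gtrN// ltr0n.
  - exact: continuous_subspaceT.
  - split; [move=> x _; exact: ex_derive| |].
    + exact/cvg_at_right_filter/cF.
    + exact/cvg_at_left_filter/cF.
  - by move=> x _; rewrite derive1E; exact: derive_val.
have L1 : \int[mu]_(x in I n) f x @[n --> \oo] --> (0 : R).
  rewrite -(subrr 0); apply: cvg_trans (cvgB Fp Fn).
  apply: near_eq_cvg; near=> n; rewrite E//; near: n; exact: nbhs_infty_gt.
have L2 : \int[mu]_(x in I n) f x @[n --> \oo] --> \int[mu]_x f x.
  rewrite /Rintegral; apply: fine_cvg; rewrite fineK; last exact: integrable_fin_num.
  under eq_fun do rewrite integral_mkcond.
  apply: (@dominated_cvg _ _ _ mu setT measurableT _ (EFin \o f) (fun x => `|(f x)%:E|%E)) => //.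
  - move=> n; apply/(measurable_restrictT _ _).1; first exact: measurable_itv.
    by apply/measurable_EFinP; apply: continuous_measurableT.
  - move=> x _; apply: cvg_near_cst; near=> n.
    rewrite patchE mem_set// /I /= in_itv /= -ler_norml.
    near: n; exact: nbhs_infty_ger.
  - exact: integrable_abse.
  - by move=> n x _; rewrite patchE; case: ifPn => //= _; rewrite normr0 lee_fin.
exact: cvg_unique L2 L1.
Unshelve. all: by end_near. Qed.

Lemma is_derive_mul_r z x : is_derive z 1 (fun z => z * x) x.
Proof. by apply: is_derive_eq; rewrite ?scaler0 ?add0r ?addr0 /GRing.scale/= mulr1. Qed.

Lemma is_derive_mul_l z x : is_derive x 1 (fun x => z * x) z.
Proof. by apply: is_derive_eq; rewrite ?scaler0 ?add0r ?addr0 /GRing.scale/= mulr1. Qed.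

Lemma is_derive_cosM z x : is_derive z 1 (fun z => cos (z * x) * gw x) (- x * sin (z * x) * gw x).
Proof.
have := @is_derive1_comp R cos (fun u => u * x) z _ _ (is_derive_cos (z * x)) (is_derive_mul_r z x).
rewrite mulNr mulrC -mulNr => d.
have := is_derive_mul_r (cos (z * x)) (gw x) => e.
rewrite mulrC; exact: (@is_derive1_comp R (fun u => u * gw x) (cos \o fun u => u * x) z _ _ e d).
Qed.

Lemma is_derive_sinM z x : is_derive x 1 (fun x => sin (z * x) * gw x)
  (z * cos (z * x) * gw x - x * sin (z * x) * gw x).
Proof.
have d := is_derive1_comp (is_derive_sin (z * x)) (is_derive_mul_l z x).
have e := is_derive_gw x.
have [D v] := is_deriveM d e; apply: DeriveDef; first exact: D.
rewrite [LHS]v /GRing.scale/=; ring.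
Qed.

Lemma continuous_cosgw z b : continuous (fun x => cos (z * x + b) * gw x).
Proof.
move=> x; apply: continuousM; last exact: continuous_gauss.
apply: continuous_comp; last exact: continuous_cos.
by apply: continuousD; [exact: mulrl_continuous|exact: cst_continuous].
Qed.

Lemma integrable_cosgw z b : mu.-integrable setT (EFin \o (fun x => cos (z * x + b) * gw x)).
Proof.
apply: (@integrable_dom 1 1 (fun x => cos (z * x + b) * gw x)) => //.
  exact: continuous_cosgw.
by move=> x; rewrite normrM mul1r (ger0_norm (gauss_ge0 _ _)) ler_piMl ?gauss_ge0 ?cos_max.
Qed.

Lemma continuous_xsingw z : continuous (fun x : R => x * sin (z * x) * gw x).
Proof.
move=> x; apply: (@continuousM _ _ (fun x => x * sin (z * x))); last exact: continuous_gauss.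
by apply: (@continuousM _ _ idfun (fun x => sin (z * x))); [exact: cvg_id|exact: continuous_sinM].
Qed.

Lemma integrable_xsingw z : mu.-integrable setT (EFin \o (fun x => x * sin (z * x) * gw x)).
Proof.
apply: (@integrable_dom 2 1 (fun x => x * sin (z * x) * gw x)) => //.
  exact: continuous_xsingw.
move=> x; rewrite mul1r; apply: le_trans (norm_mul_gw x).
rewrite !normrM (ger0_norm (gauss_ge0 _ _)) ler_wpM2r ?gauss_ge0//.
by rewrite ler_piMr ?sin_max.
Qed.

Let G z := \int[mu]_x (cos (z * x) * gw x).

Lemma integrable_cosgw0 z : mu.-integrable setT (EFin \o (fun x => cos (z * x) * gw x)).
Proof.
rewrite (_ : (fun x => _) = (fun x => cos (z * x + 0) * gw x)); first exact: integrable_cosgw.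
by apply/funext => x; rewrite addr0.
Qed.

(** Integration by parts: z cos (z x) gw x - x sin (z x) gw x is the derivative of sin (z x) gw x,
    so its integral vanishes. *)
Lemma Rintegral_xsingw z : \int[mu]_x (x * sin (z * x) * gw x) = z * G z.
Proof.
apply/esym/eqP; rewrite -subr_eq0 /G -RintegralZl//; last exact: integrable_cosgw0.
rewrite -RintegralB//; last 2 first.
- by have := integrableZl measurableT z (integrable_cosgw0 z); under eq_fun do rewrite -EFinM.
- exact: integrable_xsingw.
apply/eqP; rewrite (_ : \int[mu]_x _ = \int[mu]_x (z * cos (z * x) * gw x - x * sin (z * x) * gw x)); last first.
  by congr Rintegral; apply/funext => x; rewrite mulrA.
apply: (@Rintegral_derive_eq0 (fun x => sin (z * x) * gw x) _ 1).
- exact: is_derive_sinM.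
- move=> x; apply: (@continuousB _ R^o _ (fun x => z * cos (z * x) * gw x)).
    apply: (@continuousM _ _ (fun x => z * cos (z * x))); last exact: continuous_gauss.
    by apply: (@continuousM _ _ (cst z)); [exact: cst_continuous|exact: continuous_cosM].
  exact: continuous_xsingw.
- have := integrableB measurableT (integrableZl measurableT z (integrable_cosgw0 z)) (integrable_xsingw z).
  by apply: eq_integrable => // x _; rewrite /= -(mulrA z).
- by move=> x; rewrite mul1r normrM (ger0_norm (gauss_ge0 _ _)) ler_piMl ?gauss_ge0 ?sin_max.
Qed.

Lemma is_derive_Rintegral_cosgw z : is_derive z 1 G (- z * G z).
Proof.
have Iz : `]z - 1, z + 1[%classic z by rewrite /= in_itv /= ltrDl ltrBlDr ltrDl ltr01.
pose f u x := cos (u * x) * gw x.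
have dE u x : partial1of2 f u x = - x * sin (u * x) * gw x.
  by rewrite partial1of2E; apply: derive_val; exact: is_derive_cosM.
have H1 : forall u, `]z - 1, z + 1[%classic u -> mu.-integrable setT (EFin \o f u).
  by move=> u _; exact: integrable_cosgw0.
have H2 : forall u x, `]z - 1, z + 1[%classic u -> [set: R] x -> derivable (f^~ x) u 1.
  by move=> u x _ _; apply: ex_derive; exact: is_derive_cosM.
have H3 : forall u x, `]z - 1, z + 1[%classic u -> [set: R] x -> `|partial1of2 f u x| <= gauss 2 x.
  move=> u x _ _; rewrite dE; apply: le_trans (norm_mul_gw x).
  rewrite !normrM normrN (ger0_norm (gauss_ge0 _ _)) ler_wpM2r ?gauss_ge0//.
  by rewrite ler_piMr ?sin_max.
have i2 := integrable_gauss (ltr0n R 2).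
have D := derivable_under_integral measurableT Iz H1 H2 (@gauss_ge0 2) i2 H3.
have E := differentiation_under_integral measurableT Iz H1 H2 (@gauss_ge0 2) i2 H3.
apply: DeriveDef => //; rewrite -derive1E [LHS]E mulNr -Rintegral_xsingw.
rewrite -mulN1r -RintegralZl//; last exact: integrable_xsingw.
by apply: eq_Rintegral => x _; rewrite dE !mulNr mul1r.
Qed.

(** The equation G' = - z G says that G(u) exp (u^2 / 2) has zero derivative; its constant value is
    read off at u = 0. *)
Lemma Rintegral_cosgw z : G z = Num.sqrt (pi *+ 2) * gw z.
Proof.
pose h u := G u * expR (2^-1 * u ^+ 2).
have dh (u : R) : is_derive u 1 h 0.
  have e : is_derive u 1 (fun u : R => expR (2^-1 * u ^+ 2)) (u * expR (2^-1 * u ^+ 2)).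
    apply: is_derive_eq; rewrite /= ?scaler1 ?scaler0 ?addr0 /GRing.scale/=.
    by rewrite mulrC; congr (_ * _); lra.
  have [D v] := is_deriveM (is_derive_Rintegral_cosgw u) e; apply: DeriveDef; first exact: D.
  by rewrite [LHS]v /GRing.scale/=; ring.
have := is_derive_0_is_cst z 0 dh.
rewrite /h expr0n mulr0 expR0 mulr1 gwE mulrC => hE.
have -> : G z = expR (- (2^-1 * z ^+ 2)) * (expR (2^-1 * z ^+ 2) * G z).
  by rewrite mulrA -expRD addNr expR0 mul1r.
rewrite hE mulrC [z ^+ 2 / 2]mulrC; congr (_ * _).
rewrite /G; under eq_Rintegral do rewrite mul0r cos0 mul1r.
by rewrite /Rintegral integral_gauss// mul1r.
Qed.

(** * Affine substitution on the line *)

Section affine.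
Variables (u b : R).
Let phi : measurableTypeR R -> measurableTypeR R := fun x => u * x + b.

Lemma measurable_affine : measurable_fun setT phi.
Proof. by apply: measurable_funD => //; exact: mulrl_measurable. Qed.

(** By uniqueness of Lebesgue measure, it suffices to compare both measures on half-open
    intervals. *)
Lemma lebesgue_measure_affine (u0 : 0 < u) (A : set R) : measurable A ->
  (mu A = mscale (NngNum (ltW u0))
    (measure_function_pushforward__canonical__measure_function_Measure mu measurable_affine) A)%E.
Proof.
move=> mA; apply: lebesgue_measure_unique => // _ [[x y] _ <-].
transitivity (u%:E * mu (phi @^-1` `]x, y]))%E; last by [].
rewrite (_ : phi @^-1` _ = `](x - b) / u, (y - b) / u]%classic); last first.
  apply/seteqP; split => z; rewrite /= !in_itv/= /phi.
    by rewrite ltr_pdivrMr// ler_pdivlMr// ltrBlDr lerBrDr mulrC.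
  by rewrite ltr_pdivrMr// ler_pdivlMr// ltrBlDr lerBrDr mulrC.
rewrite !lebesgue_measure_itv/= !lte_fin ltr_pM2r ?invr_gt0// ltrD2r.
case: ifPn => _; last by rewrite mule0.
by rewrite -!EFinD -EFinM; congr EFin; field; rewrite gt_eqF.
Qed.
End affine.

Lemma ge0_integral_affine_pos (u b : R) (f : R -> \bar R) : 0 < u ->
  measurable_fun setT f -> (forall x, 0 <= f x)%E ->
  (\int[mu]_x f (u * x + b)%R = u^-1%:E * \int[mu]_x f x)%E.
Proof.
move=> u0 mf f0.
have -> : (\int[mu]_x f x = \int[mscale (NngNum (ltW u0))
    (measure_function_pushforward__canonical__measure_function_Measure mu (measurable_affine u b))]_x f x)%E.
  by apply: eq_measure_integral => A mA _; exact: lebesgue_measure_affine.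
rewrite ge0_integral_mscale//= ge0_integral_pushforward//; last exact: measurable_affine.
by rewrite muleA -EFinM mulVf ?gt_eqF// mul1e.
Qed.

Lemma ge0_integral_opp (f : R -> \bar R) :
  measurable_fun setT f -> (forall x, 0 <= f x)%E ->
  (\int[mu]_x f (- x)%R = \int[mu]_x f x)%E.
Proof.
move=> mf f0.
have mo : measurable_fun setT (-%R : measurableTypeR R -> measurableTypeR R) by [].
rewrite -[LHS](@ge0_integral_pushforward _ _ _ _ R _ mo mu setT f)//.
by apply: eq_measure_integral => A mA _; exact: lebesgue_measureN.
Qed.

Lemma ge0_integral_affine (u b : R) (f : R -> \bar R) : u != 0 ->
  measurable_fun setT f -> (forall x, 0 <= f x)%E ->
  (\int[mu]_x f (u * x + b)%R = `|u|^-1%:E * \int[mu]_x f x)%E.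
Proof.
move=> u0 mf f0; have [u0'|u0'] := ltP 0 u.
  by rewrite ge0_integral_affine_pos// gtr0_norm.
have ltu : u < 0 by rewrite lt_neqAle u0.
rewrite -ge0_integral_opp; last 2 first.
- by apply: measurableT_comp => //; exact: measurable_affine.
- by move=> x; exact: f0.
under eq_integral do rewrite mulrN -mulNr.
by rewrite ge0_integral_affine_pos ?oppr_gt0// ltr0_norm.
Qed.

(* The constant 1 keeps the integrand nonnegative, hence within the scope of Tonelli *)
Lemma integral_1cos_gw z b :
  (\int[mu]_x ((1 + cos (z * x + b)) * gw x)%:E =
   (Num.sqrt (pi *+ 2) * (1 + cos b * gw z))%:E)%E.
Proof.
have i1 := integrable_gauss (@ltr01 R).
pose C z := \int[mu]_x (cos (z * x + b) * gw x).
have E1 y : (\int[mu]_x ((1 + cos (y * x + b)) * gw x)%:E =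
          (Num.sqrt (pi *+ 2) + C y)%:E)%E.
  under eq_integral do rewrite mulrDl mul1r EFinD.
  rewrite integralD//=; last exact: integrable_cosgw.
  rewrite integral_gauss// mul1r EFinD; congr (_ + _)%E.
  by rewrite /C /Rintegral fineK//; apply: integrable_fin_num => //; exact: integrable_cosgw.
(* Reflecting x, under which [gw] is even, gives C(z) = C(-z); the addition formula gives C(z) +
   C(-z) = 2 cos b G(z). Together they eliminate the sine part. *)
have CN : C z = C (- z).
  have : (Num.sqrt (pi *+ 2) + C z)%:E = (Num.sqrt (pi *+ 2) + C (- z))%:E.
    rewrite -!E1 -ge0_integral_opp.
    - by apply: eq_integral => x _; rewrite mulrN mulNr gaussN.
    - apply/measurable_EFinP; apply: continuous_measurableT => x.
      apply: (@continuousM _ _ (fun x => 1 + cos (z * x + b))); last exact: continuous_gauss.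
      apply: (@continuousD _ R^o); first exact: cst_continuous.
      apply: continuous_comp; last exact: continuous_cos.
      by apply: continuousD; [exact: mulrl_continuous|exact: cst_continuous].
    - by move=> x; rewrite lee_fin mulr_ge0 ?gauss_ge0// -lerBlDl sub0r cos_geN1.
  by move=> [] /addrI.
have CD : C z + C (- z) = 2 * cos b * G z.
  rewrite /C /G -RintegralD//; [|exact: integrable_cosgw..].
  rewrite -RintegralZl//; last exact: integrable_cosgw0.
  apply: eq_Rintegral => x _; rewrite mulNr !cosD cosN sinN; ring.
rewrite E1 mulrDr mulr1; congr (_ + _)%:E.
have -> : C z = cos b * G z by move: CD; rewrite -CN; lra.
by rewrite Rintegral_cosgw; ring.
Qed.

End gauss.

(** * Lebesgue measure and linear substitution on R^d *)

(* Iterating products of measures needs the sigma-finite structure bundled with the product *)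
Definition prod_sf d1 d2 (T1 : measurableType d1) (T2 : measurableType d2)
    (R : realType) (m1 : {sigma_finite_measure set T1 -> \bar R})
    (m2 : {sigma_finite_measure set T2 -> \bar R}) :
    {sigma_finite_measure set (T1 * T2)%type -> \bar R} :=
  HB.pack (m1 \x m2)%E
   (lebesgue_integral_fubini.measure_function_Measure_isSigmaFinite__to__measure_function_isSFinite m1 m2)
   (lebesgue_integral_fubini.measure_function_Measure_isSigmaFinite__to__measure_function_isSigmaFinite m1 m2).

Section Rd.
Context {R : realType}.
Notation mu := (@lebesgue_measure R).

(* R^d as R * (R * ...), so that Tonelli's theorem applies by recursion on [d] *)
Fixpoint Rd_ (d : nat) : {disp & measurableType disp} :=
  match d with
  | 0 => existT _ _ (unit : measurableType _)
  | d'.+1 => existT _ _ ((measurableTypeR R * projT2 (Rd_ d'))%type : measurableType _)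
  end.
Definition Rd d := projT2 (Rd_ d).

Fixpoint lam (d : nat) : {sigma_finite_measure set (Rd d) -> \bar R} :=
  match d with
  | 0 => (\d_tt : {sigma_finite_measure set (Rd 0) -> \bar R})
  | d'.+1 => prod_sf mu (lam d')
  end.

Fixpoint vec (d : nat) : Rd d -> 'cV[R]_d :=
  match d with
  | 0 => fun=> 0
  | d'.+1 => fun p => col_mx (p.1 : R)%:M (vec p.2) : 'cV[R]_(1 + d')
  end.

Lemma vec_cons d (x : R) (y : Rd d) :
  vec ((x, y) : Rd d.+1) = col_mx x%:M (vec y) :> 'cV[R]_(1 + d).
Proof. by []. Qed.

Lemma tonelli_recl d (F : Rd d.+1 -> \bar R) : measurable_fun setT F -> (forall x, 0 <= F x)%E ->
  (\int[lam d.+1]_x F x = \int[mu]_x \int[lam d]_y F (x, y))%E.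
Proof. exact: (@fubini_tonelli1 _ _ _ _ _ mu (lam d)). Qed.

Lemma tonelli_recr d (F : Rd d.+1 -> \bar R) : measurable_fun setT F -> (forall x, 0 <= F x)%E ->
  (\int[lam d.+1]_x F x = \int[lam d]_y \int[mu]_x F (x, y))%E.
Proof. exact: (@fubini_tonelli2 _ _ _ _ _ mu (lam d)). Qed.

Lemma measurable_recl d (F : Rd d.+1 -> \bar R) : measurable_fun setT F -> (forall x, 0 <= F x)%E ->
  measurable_fun setT (fun x : R => \int[lam d]_y F (x, y))%E.
Proof. exact: (@measurable_fun_fubini_tonelli_F _ _ _ _ _ (lam d)). Qed.

Lemma measurable_recr d (F : Rd d.+1 -> \bar R) : measurable_fun setT F -> (forall x, 0 <= F x)%E ->
  measurable_fun setT (fun y => \int[mu]_x F (x, y))%E.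
Proof. exact: (@measurable_fun_fubini_tonelli_G _ _ _ _ _ mu). Qed.

Lemma measurable_vec d (i : 'I_d) : measurable_fun setT (fun x : Rd d => vec x i 0).
Proof.
elim: d i => [|d IH] i; first by case: i.
have [j ->|j ->] := split_ordP (i : 'I_(1 + d)).
- rewrite (_ : (fun x => _) = fst); first exact: measurable_fst.
  by apply/funext => -[x y]; rewrite [LHS]col_mxEu (ord1 j) mxE.
- rewrite (_ : (fun x => _) = (fun x : Rd d => vec x j 0) \o snd).
    by apply: measurableT_comp; [exact: IH|exact: measurable_snd].
  by apply/funext => -[x y]; rewrite [LHS]col_mxEd.
Qed.

Lemma measurable_linform d N (A : 'M[R]_(N, d)) (w : 'cV[R]_N) i :
  measurable_fun setT (fun x : Rd d => (A *m vec x + w) i 0).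
Proof.
rewrite (_ : (fun x => _) = (fun x => \sum_j A i j * vec x j 0 + w i 0)); last first.
  by apply/funext => x; rewrite !mxE.
apply: measurable_funD => //; apply: measurable_sum => j.
by apply: measurable_funM => //; exact: measurable_vec.
Qed.

(** The shift [w] makes the family stable under freezing the first coordinate, which only moves [w].
    Iterated integration therefore stays inside the family, and inductions on [d] go through. *)
Definition prodlin d N (f : 'I_N -> R -> R) (A : 'M[R]_(N, d)) (w : 'cV[R]_N) (x : Rd d) : \bar R :=
  (\prod_(i < N) f i ((A *m vec x + w) i 0))%:E.

Definition gint d N (f : 'I_N -> R -> R) (A : 'M[R]_(N, d)) (w : 'cV[R]_N) : \bar R :=
  (\int[lam d]_x prodlin f A w x)%E.

Lemma prodlin_cons d N (f : 'I_N -> R -> R) (A : 'M[R]_(N, 1 + d)) w (x : R) (y : Rd d) :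
  prodlin (d := d.+1) f A w (x, y) = prodlin f (rsubmx A) (w + x *: lsubmx A) y.
Proof.
rewrite /prodlin; congr EFin; apply: eq_bigr => i _; congr (f i (_ i 0)).
have -> : A *m vec ((x, y) : Rd d.+1) = x *: lsubmx A + rsubmx A *m vec y.
  by rewrite vec_cons -{1}(hsubmxK A) mul_row_col mul_mx_scalar.
by rewrite addrC addrA addrC.
Qed.

Section lin.
Context (N : nat) (f : 'I_N -> R -> R).
Hypothesis mf : forall i, measurable_fun setT (f i).
Hypothesis f0 : forall i x, 0 <= f i x.

Lemma prodlin_ge0 d (A : 'M[R]_(N, d)) w x : (0 <= prodlin f A w x)%E.
Proof. by rewrite lee_fin prodr_ge0. Qed.

Lemma measurable_prodlin d (A : 'M[R]_(N, d)) (w : 'cV[R]_N) :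
  measurable_fun setT (prodlin f A w).
Proof.
apply/measurable_EFinP; apply: measurable_prod => i _.
apply: (measurableT_comp (mf i)); exact: measurable_linform.
Qed.

Lemma gint_recl d (A : 'M[R]_(N, 1 + d)) w :
  gint (d := d.+1) f A w = (\int[mu]_x gint f (rsubmx A) (w + x *: lsubmx A))%E.
Proof.
rewrite /gint tonelli_recl.
- by apply: eq_integral => x _; apply: eq_integral => y _; rewrite prodlin_cons.
- exact: measurable_prodlin.
- exact: prodlin_ge0.
Qed.

Lemma gint_recr d (A : 'M[R]_(N, 1 + d)) w :
  gint (d := d.+1) f A w =
  (\int[lam d]_y \int[mu]_x prodlin f (rsubmx A) (w + x *: lsubmx A) y)%E.
Proof.
rewrite /gint tonelli_recr.
- by apply: eq_integral => x _; apply: eq_integral => y _; rewrite prodlin_cons.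
- exact: measurable_prodlin.
- exact: prodlin_ge0.
Qed.

Lemma gint_ge0 d (A : 'M[R]_(N, d)) w : (0 <= gint f A w)%E.
Proof. by apply: integral_ge0 => x _; exact: prodlin_ge0. Qed.

Lemma measurable_gint d (A : 'M[R]_(N, d)) (w v : 'cV[R]_N) :
  measurable_fun setT (fun x : R => gint f A (w + x *: v)).
Proof.
have := measurable_recl (@measurable_prodlin d.+1 (row_mx v A) w) (@prodlin_ge0 d.+1 _ _).
apply: eq_measurable_fun => x _; apply: eq_integral => y _.
by rewrite prodlin_cons row_mxKl row_mxKr.
Qed.

Lemma measurable_gint_inner d (A : 'M[R]_(N, d)) (w v : 'cV[R]_N) :
  measurable_fun setT (fun y : Rd d => \int[mu]_x prodlin f A (w + x *: v) y)%E.
Proof.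
have := measurable_recr (@measurable_prodlin d.+1 (row_mx v A) w) (@prodlin_ge0 d.+1 _ _).
apply: eq_measurable_fun => y _; apply: eq_integral => x _.
by rewrite prodlin_cons row_mxKl row_mxKr.
Qed.

End lin.

(* [E] scales integrals by [c], for every product integrand and every translation of the source *)
Definition rescales d (E : 'M[R]_d) (c : R) := forall N (f : 'I_N -> R -> R),
  (forall i, measurable_fun setT (f i)) -> (forall i x, 0 <= f i x) ->
  forall (A : 'M[R]_(N, d)) (w : 'cV[R]_N) b,
    gint f (A *m E) (w + A *m b) = (c%:E * gint f A w)%E.

Lemma rescales0 (E : 'M[R]_0) : rescales E 1.
Proof. by move=> N f mf f0 A w b; rewrite (thinmx0 A) !mul0mx addr0 mul1e. Qed.

(** The first coordinate is integrated innermost: with the others frozen, it enters as u x plus a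
    constant, so the affine substitution removes [r] and yields 1 / |u|. The hypothesis on [E] then
    treats the other coordinates. *)
Lemma rescales_upper d (u : R) (r : 'rV[R]_d) (E : 'M[R]_d) c : u != 0 -> 0 <= c ->
  rescales E c -> rescales (block_mx u%:M r 0 E : 'M[R]_(1 + d)) (`|u|^-1 * c).
Proof.
move=> u0 c0 HE N f mf f0 A w b.
rewrite -(hsubmxK A) -(vsubmxK b); set a := lsubmx A; set A' := rsubmx A.
set b1 := usubmx b; set b2 := dsubmx b.
rewrite (mul_row_block a A') mulmx0 addr0 mul_row_col.
have -> : b1 = (b1 0 0)%:M by rewrite [LHS]mx11_scalar.
set beta := b1 0 0; rewrite !mul_mx_scalar.
rewrite gint_recr// row_mxKl row_mxKr.
transitivity (\int[lam d]_y (`|u|^-1%:E * \int[mu]_x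
   prodlin f (A' *m E) (w + A' *m b2 + x *: a) y))%E.
  apply: eq_integral => y _.
  pose g x := prodlin f (A' *m E) (w + A' *m b2 + x *: a) y.
  rewrite -[RHS](@ge0_integral_affine _ u ((r *m vec y) 0 0 + beta) g)//.
  - apply: eq_integral => x _; congr EFin; apply: eq_bigr => i _; congr (f i _).
    have -> : (a *m r + A' *m E) *m vec y = ((r *m vec y) 0 0) *: a + A' *m E *m vec y.
      rewrite mulmxDl -mulmxA; congr (_ + _).
      by rewrite -mul_mx_scalar -mx11_scalar.
    by rewrite !mxE; ring.
  - apply/measurable_EFinP; apply: measurable_prod => i _; apply: (measurableT_comp (mf i)).
    rewrite (_ : (fun x => _) = (fun x => (A' *m E *m vec y + (w + A' *m b2)) i 0 + x * a i 0)); last first.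
      by apply/funext => x; rewrite !mxE addrA.
    by apply: measurable_funD => //; apply: measurable_funM.
  - by move=> x; exact: prodlin_ge0.
rewrite ge0_integralZl//=; last 2 first.
- exact: measurable_gint_inner.
- by move=> y _; apply: integral_ge0 => x _; exact: prodlin_ge0.
have := gint_recr mf f0 (row_mx a (A' *m E)) (w + A' *m b2).
rewrite row_mxKl row_mxKr => <-.
rewrite gint_recl// row_mxKl row_mxKr EFinM -muleA; congr (_ * _)%E.
transitivity (\int[mu]_x (c%:E * gint f A' (w + x *: a)))%E.
  by apply: eq_integral => x _; rewrite addrAC HE.
rewrite [in RHS]gint_recl// row_mxKl row_mxKr.
rewrite ge0_integralZl//; first exact: measurable_gint.
by move=> x _; exact: gint_ge0.
Qed.

End Rd.

Section Rd.
Context {R : realType}.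
Notation mu := (@lebesgue_measure R).

(** Opposite order of integration: with the first coordinate x frozen, the column [v] only
    translates the remaining coordinates by x v, which the arbitrary [b] in [rescales] absorbs. *)
Lemma rescales_lower d (v : 'cV[R]_d) (E : 'M[R]_d) c : 0 <= c ->
  rescales E c -> rescales (block_mx 1%:M 0 v E : 'M[R]_(1 + d)) c.
Proof.
move=> c0 HE N f mf f0 A w b.
rewrite -(hsubmxK A) -(vsubmxK b); set a := lsubmx A; set A' := rsubmx A.
set b1 := usubmx b; set b2 := dsubmx b.
rewrite (mul_row_block a A') mulmx0 add0r mul_row_col mulmx1.
have -> : b1 = (b1 0 0)%:M by rewrite [LHS]mx11_scalar.
set beta := b1 0 0; rewrite mul_mx_scalar.
rewrite gint_recl// row_mxKl row_mxKr.
transitivity (\int[mu]_x (c%:E * gint f A' (w + (1 * x + beta) *: a)))%E.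
  apply: eq_integral => x _.
  rewrite -[RHS](HE _ _ mf f0 _ _ (b2 + x *: v)).
  have -> // : w + (beta *: a + A' *m b2) + x *: (a + A' *m v) =
    w + (1 * x + beta) *: a + A' *m (b2 + x *: v).
  rewrite mulmxDr -scalemxAr mul1r scalerDr scalerDl -!addrA; congr (w + _).
  by rewrite [RHS]addrCA; congr (_ + _); rewrite addrCA.
have m1 := measurable_gint mf f0 A' w a.
rewrite ge0_integralZl//; last 2 first.
- by apply: (measurableT_comp m1); apply: measurable_funD => //; exact: mulrl_measurable.
- by move=> x _; exact: gint_ge0.
rewrite (@ge0_integral_affine _ 1 beta (fun x => gint f A' (w + x *: a)))//; last first.
  by move=> x; exact: gint_ge0.
have := gint_recl mf f0 (row_mx a A') w.
rewrite row_mxKl row_mxKr => ->.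
by rewrite normr1 invr1 mul1e.
Qed.

End Rd.

Section Rd.
Context {R : realType}.
Notation mu := (@lebesgue_measure R).

Lemma rescales_upper_tri d (U : 'M[R]_d) : (forall i j : 'I_d, (j < i)%N -> U i j = 0) ->
  (forall i, U i i != 0) -> rescales U `|\det U|^-1.
Proof.
elim: d U => [|d IH] U Ut U0; first by rewrite det_mx00 normr1 invr1; exact: rescales0.
pose U' : 'M[R]_(1 + d) := U.
have E : U' = block_mx (U 0 0)%:M (ursubmx U') 0 (drsubmx U').
  rewrite -[LHS]submxK; congr block_mx.
    by rewrite [LHS]mx11_scalar; congr (_%:M); rewrite !mxE; congr (U _ _); apply/val_inj.
  by apply/matrixP => i j; rewrite !mxE Ut//= ord1.
rewrite -[U]/U' E (@det_ublock _ 1) det_scalar1 normrM invfM.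
apply: rescales_upper; [exact: U0|by rewrite invr_ge0|apply: IH].
- by move=> i j ij; rewrite !mxE Ut.
- by move=> i; rewrite !mxE U0.
Qed.

Lemma rescales_lower_tri d (L : 'M[R]_d) :
  (forall i j : 'I_d, (i <= j)%N -> L i j = (i == j)%:R) -> rescales L 1.
Proof.
elim: d L => [|d IH] L Lt; first exact: rescales0.
pose L' : 'M[R]_(1 + d) := L.
have E : L' = block_mx 1%:M 0 (dlsubmx L') (drsubmx L').
  rewrite -[LHS]submxK; congr block_mx.
    by rewrite [LHS]mx11_scalar; congr (_%:M); rewrite !mxE Lt.
  by apply/matrixP => i j; rewrite !mxE Lt//= ord1.
rewrite -[L]/L' E; apply: rescales_lower => //; apply: IH.
by move=> i j ij; rewrite !mxE Lt// (inj_eq (@rshift_inj 1 d)).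
Qed.

Lemma vec_cons0 d (x : R) (y : Rd d) : vec ((x, y) : Rd d.+1) ord0 0 = x.
Proof.
have -> : ord0 = lshift d (ord0 : 'I_1) :> 'I_d.+1 by exact/val_inj.
by rewrite vec_cons [LHS]col_mxEu mxE.
Qed.

Lemma vec_consS d (x : R) (y : Rd d) i : vec ((x, y) : Rd d.+1) (lift ord0 i) 0 = vec y i 0.
Proof.
have -> : lift ord0 i = rshift 1 i :> 'I_d.+1 by exact/val_inj.
by rewrite vec_cons [LHS]col_mxEd.
Qed.

(** The permutation is moved from the coordinates to the labels of the functions; what remains is a
    product over coordinates, split by Tonelli and induction on [d]. *)
Lemma gint_perm d (f : 'I_d -> R -> R) (s : 'S_d) :
  (forall i, measurable_fun setT (f i)) -> (forall i x, 0 <= f i x) ->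
  gint f (perm_mx s) 0 = (\prod_i \int[mu]_x (f i x)%:E)%E.
Proof.
move=> mf f0.
have -> : gint f (perm_mx s) 0 = (\int[lam d]_x (\prod_(i < d) f ((s^-1)%g i) (vec x i 0))%:E)%E.
  apply: eq_integral => x _; congr EFin.
  rewrite [RHS](reindex_inj (@perm_inj _ s)); apply: eq_bigr => i _.
  by rewrite permK addr0 -row_permE mxE.
rewrite (reindex_inj (@perm_inj _ (s^-1)%g)) /=.
set g := fun i => f ((s^-1)%g i).
have mg i : measurable_fun setT (g i) by exact: mf.
have g0 i x : 0 <= g i x by exact: f0.
rewrite -[RHS]/(\prod_i \int[mu]_x (g i x)%:E)%E.
rewrite -[LHS]/(\int[lam d]_x (\prod_(i < d) g i (vec x i 0))%:E)%E.
clearbody g; move: {f mf f0 s} g mg g0; elim: d => [|d IH] g mg g0.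
  rewrite big_ord0 (eq_integral (cst 1%E)) ?integral_cst//=; last first.
    by move=> x _; rewrite big_ord0.
  by rewrite mul1e diracE mem_set.
rewrite tonelli_recl; last 2 first.
- apply/measurable_EFinP; apply: measurable_prod => i _.
  by apply: (measurableT_comp (mg i)); exact: measurable_vec.
- by move=> x; rewrite lee_fin prodr_ge0.
pose gt i := g (rshift 1 i : 'I_d.+1).
have IHg : (\int[lam d]_y (\prod_(i < d) gt i (vec y i 0))%:E = \prod_i \int[mu]_x (gt i x)%:E)%E.
  by apply: IH => [i|i x]; [exact: mg|exact: g0].
rewrite big_ord_recl.
transitivity (\int[mu]_x ((g ord0 x)%:E * \prod_i \int[mu]_x (gt i x)%:E))%E.
  apply: eq_integral => x _; rewrite -IHg -ge0_integralZl//.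
  - apply: eq_integral => y _; rewrite big_ord_recl EFinM; congr (_ * _)%E.
      by congr (g _ _)%:E; rewrite vec_cons0.
    congr EFin; apply: eq_bigr => i _.
    by rewrite /gt vec_consS (_ : lift ord0 i = rshift 1 i)//; exact/val_inj.
  - apply/measurable_EFinP; apply: measurable_prod => i _.
    by apply: (measurableT_comp (mg _)); exact: measurable_vec.
  - by move=> y _; rewrite lee_fin prodr_ge0// => i _; exact: g0.
  - by rewrite lee_fin.
rewrite ge0_integralZr//; last 3 first.
- by apply/measurable_EFinP; exact: mg.
- by move=> x _; rewrite lee_fin.
- by apply: prode_ge0 => i _; apply: integral_ge0 => x _; rewrite lee_fin; exact: g0.
congr (_ * _)%E; apply: eq_bigr => i _; apply: eq_integral => x _.
by rewrite /gt (_ : lift ord0 i = rshift 1 i)//; exact/val_inj.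
Qed.

(** Change of variables through the LUP factorisation: [A] is a permutation times L times U. The
    factors U and then L are stripped from the right by [rescales], L costs nothing since it is
    unipotent, and the permutation is left to [gint_perm]. *)
Lemma gint_linear d (f : 'I_d -> R -> R) (A : 'M[R]_d) :
  (forall i, measurable_fun setT (f i)) -> (forall i x, 0 <= f i x) -> A \in unitmx ->
  gint f A 0 = (`|\det A|^-1%:E * \prod_i \int[mu]_x (f i x)%:E)%E.
Proof.
case: d f A => [|d] f A mf f0 uA.
  by rewrite -(gint_perm 1%g) // det_mx00 normr1 invr1 mul1e perm_mx1 (thinmx0 A) (thinmx0 1%:M).
have := cormen_lup_correct A; have := cormen_lup_detL A.
have := cormen_lup_lower A; have := cormen_lup_upper A; have := cormen_lup_perm A.
case: (cormen_lup A) => -[P L] U /= /is_perm_mxP[s Ps] Ut Lt dL PA.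
have dA : `|\det A| = `|\det U|.
  have := congr1 (fun M => `|\det M|) PA.
  rewrite /= !detM dL mul1r Ps det_perm normrM => <-.
  by rewrite normrX normrN1 expr1n mul1r.
have U0 i : U i i != 0.
  move: uA; rewrite unitmxE unitfE -normr_eq0 dA normr_eq0.
  rewrite -det_tr det_trig; last first.
    by apply/is_trig_mxP => a b ab; rewrite mxE Ut.
  by move/prodf_neq0/(_ i isT); rewrite mxE.
have AE : A = perm_mx (s^-1)%g *m L *m U.
  rewrite -mulmxA -[L *m U]/(L * U) -PA Ps -[perm_mx s * A]/(perm_mx s *m A) mulmxA -perm_mxM mulVg perm_mx1.
  by rewrite mul1mx.
have hU := rescales_upper_tri Ut U0 mf f0 (perm_mx (s^-1)%g *m L) 0 0.
have hL := rescales_lower_tri Lt mf f0 (perm_mx (s^-1)%g) 0 0.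
move: hU hL; rewrite !mulmx0 !addr0 -AE => -> ->.
by rewrite mul1e gint_perm// dA.
Qed.

End Rd.

(** * The Gaussian Fourier transform on R^d *)

Section Rd.
Context {R : realType}.
Notation mu := (@lebesgue_measure R).

Notation gw := (gauss (1 : R)).
Notation sq2pi := (Num.sqrt (pi *+ 2) : R).

Lemma gauss_le1 s x : gauss s x <= 1 :> R.
Proof.
rewrite /gauss -[leRHS]expR0 ler_expR oppr_le0 divr_ge0 ?sqr_ge0//.
by rewrite mulrn_wge0// sqr_ge0.
Qed.

Lemma measurable_prod_gauss d : measurable_fun setT (fun x : Rd d => \prod_i gw (vec x i 0)).
Proof.
apply: measurable_prod => i _.
apply: (measurableT_comp _ (measurable_vec i)).
by apply: continuous_measurableT; exact: continuous_gauss.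
Qed.

Lemma prod_gauss_ge0 d (x : Rd d) : 0 <= \prod_i gw (vec x i 0).
Proof. by rewrite prodr_ge0// => i _; exact: gauss_ge0. Qed.

Lemma measurable_coslin d (c : 'I_d -> R) b :
  measurable_fun setT (fun x : Rd d => cos (\sum_i c i * vec x i 0 + b)).
Proof.
apply: (@measurableT_comp _ _ _ _ _ _ (@cos R)).
  by apply: continuous_measurableT; exact: continuous_cos.
apply: measurable_funD => //; apply: measurable_sum => i.
by apply: measurable_funM => //; exact: measurable_vec.
Qed.

Definition cosgauss d (c : 'I_d -> R) b (x : Rd d) : R :=
  (1 + cos (\sum_i c i * vec x i 0 + b)) * \prod_i gw (vec x i 0).

Lemma measurable_cosgauss d (c : 'I_d -> R) b :
  measurable_fun setT (fun x : Rd d => (cosgauss c b x)%:E).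
Proof.
apply/measurable_EFinP; apply: measurable_funM; last exact: measurable_prod_gauss.
by apply: measurable_funD => //; exact: measurable_coslin.
Qed.

Lemma cosgauss_ge0 d (c : 'I_d -> R) b x : 0 <= cosgauss c b x.
Proof. by rewrite mulr_ge0 ?prod_gauss_ge0// -lerBlDl sub0r cos_geN1. Qed.

(** The Fourier transform of the Gaussian on R^d, by induction on [d]; the phase [b] is general
    because the coordinates not yet integrated enter it. *)
Lemma integral_cosgauss d (c : 'I_d -> R) b :
  (\int[lam d]_x (cosgauss c b x)%:E =
  (sq2pi ^+ d * (1 + cos b * \prod_i gw (c i)))%:E)%E.
Proof.
elim: d c b => [|d IH] c b.
  rewrite (eq_integral (cst (1 + cos b)%:E)) ?integral_cst//=; last first.
    by move=> x _; rewrite /cosgauss !big_ord0 add0r mulr1.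
  by rewrite big_ord0 expr0 mul1r mulr1 diracE mem_set// mule1.
have I1 : (\int[lam d]_x (\prod_i gw (vec x i 0))%:E = (sq2pi ^+ d)%:E)%E.
  have := IH (fun=> 0) (pi / 2); rewrite cos_pihalf mul0r addr0 mulr1 => <-.
  apply: eq_integral => x _; rewrite /cosgauss.
  have -> : \sum_i 0 * vec x i 0 = 0 by rewrite big1// => i _; rewrite mul0r.
  by rewrite add0r cos_pihalf addr0 mul1r.
rewrite tonelli_recr; last 2 first.
- exact: measurable_cosgauss.
- by move=> x; rewrite lee_fin cosgauss_ge0.
pose c' i := c (lift ord0 i); pose g := gw (c ord0).
(* Integrating the first coordinate turns 1 + cos B into 1 + g cos B = (1 - g) + g (1 + cos B). As 0
   <= g <= 1, both coefficients are nonnegative and the second term has the form of the induction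
   hypothesis. *)
transitivity (\int[lam d]_y ((sq2pi * (1 - g))%:E * (\prod_i gw (vec y i 0))%:E +
   (sq2pi * g)%:E * (cosgauss c' b y)%:E))%E.
  apply: eq_integral => y _.
  transitivity (\int[mu]_x ((\prod_i gw (vec y i 0))%:E *
     ((1 + cos (c ord0 * x + (\sum_i c' i * vec y i 0 + b))) * gw x)%:E))%E.
    apply: eq_integral => x _; rewrite -EFinM; congr EFin.
    rewrite /cosgauss !big_ord_recl vec_cons0.
    rewrite (eq_bigr (fun i => c' i * vec y i 0)) => [|i _]; last by rewrite vec_consS.
    rewrite [in X in _ * (_ * X)](eq_bigr (fun i => gw (vec y i 0))) => [|i _]; last by rewrite vec_consS.
    by rewrite -[in LHS]addrA [LHS]mulrA mulrC.
  rewrite ge0_integralZl//; last 3 first.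
  - apply/measurable_EFinP; apply: continuous_measurableT => x.
    apply: (@continuousM _ _ (fun x => 1 + cos (c ord0 * x + _))); last exact: continuous_gauss.
    apply: (@continuousD _ R^o); first exact: cst_continuous.
    apply: continuous_comp; last exact: continuous_cos.
    by apply: continuousD; [exact: mulrl_continuous|exact: cst_continuous].
  - by move=> x _; rewrite lee_fin mulr_ge0 ?gauss_ge0// -lerBlDl sub0r cos_geN1.
  - by rewrite lee_fin prod_gauss_ge0.
  rewrite integral_1cos_gw -!EFinM -EFinD; congr EFin; rewrite /cosgauss -/g; ring.
have g0 : 0 <= g by exact: gauss_ge0.
have g1 : 0 <= 1 - g by rewrite subr_ge0 gauss_le1.
have s0 : 0 <= sq2pi by exact: sqrtr_ge0.
have k1 : 0 <= sq2pi * (1 - g) by rewrite mulr_ge0.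
have k2 : 0 <= sq2pi * g by rewrite mulr_ge0.
rewrite ge0_integralD//.
- rewrite !ge0_integralZl//.
  + rewrite I1 IH -!EFinM -EFinD; congr EFin.
    by rewrite big_ord_recl -/g exprS /c'; ring.
  + exact: measurable_cosgauss.
  + by move=> x _; rewrite lee_fin cosgauss_ge0.
  + by apply/measurable_EFinP; exact: measurable_prod_gauss.
  + by move=> x _; rewrite lee_fin prod_gauss_ge0.
- by move=> x _; rewrite -EFinM lee_fin (mulr_ge0 k1)// prod_gauss_ge0.
- by apply/measurable_EFinP; apply: measurable_funM => //; exact: measurable_prod_gauss.
- by move=> x _; rewrite -EFinM lee_fin (mulr_ge0 k2)// cosgauss_ge0.
- by apply/measurable_EFinP; apply: measurable_funM => //; apply/measurable_EFinP; exact: measurable_cosgauss.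
Qed.

Lemma integral_prod_gauss d : (\int[lam d]_x (\prod_i gw (vec x i 0))%:E = (sq2pi ^+ d)%:E)%E.
Proof.
have := integral_cosgauss (fun=> 0) (pi / 2) (d := d); rewrite cos_pihalf mul0r addr0 mulr1 => <-.
apply: eq_integral => x _; rewrite /cosgauss.
have -> : \sum_i 0 * vec x i 0 = 0 by rewrite big1// => i _; rewrite mul0r.
by rewrite add0r cos_pihalf addr0 mul1r.
Qed.

End Rd.

(** * One-dimensional estimate *)

Section oned.
Context {R : realType}.
Notation mu := (@lebesgue_measure R).
Notation gw := (gauss (1 : R)).
Notation sq2pi := (Num.sqrt (pi *+ 2) : R).

Lemma sum_half_powers (m : nat) : \sum_(j < m) (2^-1 : R) ^+ j <= 2.
Proof.
suff -> : \sum_(j < m) (2^-1 : R) ^+ j = 2 - 2 * 2^-1 ^+ m.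
  by rewrite gerBl mulr_ge0// exprn_ge0// invr_ge0.
elim: m => [|m IH]; first by rewrite big_ord0 expr0; lra.
rewrite big_ord_recr/= IH exprS; lra.
Qed.

Lemma expN_nat_le (j : nat) (z : R) : j%:R <= z -> expR (- z) <= 2^-1 ^+ j.
Proof.
move=> jz; apply: (@le_trans _ _ (expR (- 1) ^+ j)).
  by rewrite -expRM_natl ler_expR mulrN1 lerN2.
apply: lerXn2r; rewrite ?nnegrE ?expR_ge0 ?invr_ge0//.
by rewrite expRN lef_pV2 ?posrE ?expR_gt0//; exact: expR_ge1Dx.
Qed.

Section conc.
Context (K : nat) (q y : 'I_K -> R) (p : R).
Hypothesis q0 : forall k, 0 <= q k.
Hypothesis q1 : \sum_k q k = 1.
Hypothesis qp : forall x, \sum_(k | `|y k - x| <= 1) q k <= p.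

(** Points with j <= |y - x| < j + 1 lie in one of the two unit balls centred at x + (j + 1/2) and x
    - (j + 1/2), of mass at most [p] each, and carry weight exp (- j) <= 2^(-j). The geometric
    series gives 2 * 2 p. *)
Lemma sum_expN_le x : \sum_k q k * expR (- `|y k - x|) <= 4 * p.
Proof.
pose J k := Num.trunc `|y k - x|.
pose m := (\max_k J k).+1.
have Jm k : (J k < m)%N by rewrite ltnS leq_bigmax.
pose B (j : nat) (k : 'I_K) : R := (`|y k - (x + (j%:R + 2^-1))| <= 1)%R%:R
   + (`|y k - (x - (j%:R + 2^-1))| <= 1)%R%:R.
have B0 j k : 0 <= B j k by rewrite addr_ge0.
have le1 k : expR (- `|y k - x|) <= \sum_(j < m) 2^-1 ^+ j * B j k.
  have /andP[J1 J2] := Num.Theory.trunc_itv (normr_ge0 (y k - x)).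
  rewrite (bigD1 (Ordinal (Jm k)))//= ler_wpDr//.
    by apply: sumr_ge0 => j _; rewrite mulr_ge0// exprn_ge0// invr_ge0.
  apply: (@le_trans _ _ (2^-1 ^+ J k)); first exact: expN_nat_le.
  rewrite ler_peMr ?exprn_ge0 ?invr_ge0//.
  move: J1 J2; rewrite -/(J k) -natr1 /B; set j := (J k)%:R.
  have [z0|z0] := leP 0 (y k - x).
    rewrite ger0_norm// => j1 j2.
    have -> : `|y k - (x + (j + 2^-1))| <= 1 by rewrite ler_norml; lra.
    by rewrite lerDl.
  rewrite ltr0_norm// => j1 j2.
  have -> : `|y k - (x - (j + 2^-1))| <= 1 by rewrite ler_norml; lra.
  by rewrite lerDr.
apply: (@le_trans _ _ (\sum_k q k * \sum_(j < m) 2^-1 ^+ j * B j k)).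
  by apply: ler_sum => k _; rewrite ler_wpM2l.
under eq_bigr do rewrite mulr_sumr.
rewrite exchange_big /=.
apply: (@le_trans _ _ (\sum_(j < m) 2^-1 ^+ j * (2 * p))).
  apply: ler_sum => j _.
  under eq_bigr do rewrite mulrCA.
  rewrite -mulr_sumr ler_wpM2l ?exprn_ge0 ?invr_ge0//.
  under eq_bigr do rewrite mulrDr.
  rewrite big_split /= mulr2n mulrDl mul1r lerD//.
    by apply: le_trans (qp (x + (j%:R + 2^-1))); rewrite [leRHS]big_mkcond; apply: ler_sum => k _; case: ifP; rewrite ?mulr1 ?mulr0.
  by apply: le_trans (qp (x - (j%:R + 2^-1))); rewrite [leRHS]big_mkcond; apply: ler_sum => k _; case: ifP; rewrite ?mulr1 ?mulr0.
have p0 : 0 <= p by apply: le_trans (qp 0); rewrite sumr_ge0.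
rewrite -mulr_suml (_ : 4 * p = 2 * (2 * p)); last ring.
by rewrite ler_wpM2r ?mulr_ge0// sum_half_powers.
Qed.

(** Completing the square, z^2 / 8 - |z| + 2 = (|z| - 4)^2 / 8 >= 0, which is the origin of
    [expR 2]. *)
Lemma sum_gauss2_le x : \sum_k q k * gauss 2 (y k - x) <= 4 * expR 2 * p.
Proof.
apply: (@le_trans _ _ (expR 2 * \sum_k q k * expR (- `|y k - x|))); last first.
  by rewrite (mulrC 4) -mulrA ler_wpM2l ?expR_ge0// sum_expN_le.
rewrite mulr_sumr; apply: ler_sum => k _; rewrite mulrCA ler_wpM2l//.
rewrite -expRD ler_expR -[X in X / _](real_normK (num_real _)).
have := sqr_ge0 (`|y k - x| - 4); lra.
Qed.

(* [psi s] is |phi(s)|^2, for phi the characteristic function of the law with weights [q] at the points [y] *)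
Definition psi s : R := (\sum_k q k * cos (s * y k)) ^+ 2 + (\sum_k q k * sin (s * y k)) ^+ 2.

Lemma psi_ge0 s : 0 <= psi s. Proof. by rewrite addr_ge0// sqr_ge0. Qed.

Lemma psiE s : psi s = \sum_k \sum_l q k * q l * cos ((y k - y l) * s).
Proof.
rewrite /psi !expr2 !big_distrlr /= -big_split /=; apply: eq_bigr => k _.
rewrite -big_split /=; apply: eq_bigr => l _.
rewrite mulrBl cosB [y k * s]mulrC [y l * s]mulrC; ring.
Qed.

Lemma sum_qq : \sum_k \sum_l q k * q l = 1.
Proof. by under eq_bigr do rewrite -mulr_sumr q1 mulr1. Qed.

Lemma one_sub_psi s : 1 - psi s = \sum_k \sum_l q k * q l * (1 - cos ((y k - y l) * s)).
Proof.
rewrite psiE -{1}sum_qq -sumrB; apply: eq_bigr => k _; rewrite -sumrB.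
by apply: eq_bigr => l _; rewrite mulrBr mulr1.
Qed.

Lemma psi_le1 s : psi s <= 1.
Proof.
rewrite -subr_ge0 one_sub_psi; apply: sumr_ge0 => k _; apply: sumr_ge0 => l _.
by rewrite !mulr_ge0// subr_ge0 cos_le1.
Qed.

(** Holds term by term in the symmetrised sum: 1 - cos 2a = 2 (1 - cos a) (1 + cos a) <= 4 (1 - cos
    a). *)
Lemma one_sub_psi2 s : 1 - psi (2 * s) <= 4 * (1 - psi s).
Proof.
rewrite !one_sub_psi mulr_sumr; apply: ler_sum => k _.
rewrite mulr_sumr; apply: ler_sum => l _.
rewrite [leRHS]mulrCA ler_wpM2l ?mulr_ge0//.
rewrite mulrCA mulr_natl cos_mulr2n.
have := cos_le1 ((y k - y l) * s); have := sqr_ge0 (1 - cos ((y k - y l) * s)); lra.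
Qed.

Lemma continuous_psi : continuous psi.
Proof.
pose C s := \sum_k q k * cos (s * y k); pose S s := \sum_k q k * sin (s * y k).
have cC : continuous C.
  apply: continuous_big => [|k _ x]; first exact: (@add_continuous R^o).
  apply: (@continuousM _ _ (cst (q k))); first exact: cst_continuous.
  by apply: continuous_comp; [exact: mulrr_continuous|exact: continuous_cos].
have cS : continuous S.
  apply: continuous_big => [|k _ x]; first exact: (@add_continuous R^o).
  apply: (@continuousM _ _ (cst (q k))); first exact: cst_continuous.
  by apply: continuous_comp; [exact: mulrr_continuous|exact: continuous_sin].
move=> s; apply: (@continuousD _ R^o _ (fun s => C s ^+ 2) (fun s => S s ^+ 2)).
  exact: (@continuous_comp _ _ _ C (fun x => x ^+ 2) s (cC s) (@exprn_continuous _ 2 _)).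
exact: (@continuous_comp _ _ _ S (fun x => x ^+ 2) s (cS s) (@exprn_continuous _ 2 _)).
Qed.

Lemma measurable_psi D : measurable_fun D psi.
Proof. exact: continuous_measurableT continuous_psi. Qed.

Lemma measurable_psi_gw D : measurable_fun D (fun s => psi s * gw s).
Proof.
apply: measurable_funM; first exact: measurable_psi.
exact: continuous_measurableT (@continuous_gauss _ _).
Qed.

(** Up to [sq2pi], the expectation of gw (Y - Y') for two independent copies of the law; by
    Plancherel it is the Gaussian-weighted L^2 mass of the characteristic function. *)
Definition Kpsi := sq2pi * \sum_k \sum_l q k * q l * gw (y k - y l).

(** 1 + psi is an average of the nonnegative functions 1 + cos ((y_k - y_l) s), whose integrals
    against [gw] are known; the finite contribution [sq2pi] of the constant 1 is then subtracted. *)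
Lemma integral_psi : (\int[mu]_s (psi s * gw s)%:E = Kpsi%:E)%E.
Proof.
have mgw : measurable_fun [set: R] (fun s => (gw s)%:E).
  by apply/measurable_EFinP; apply: continuous_measurableT; exact: continuous_gauss.
have E1 : (\int[mu]_s ((1 + psi s) * gw s)%:E = sq2pi%:E + \int[mu]_s (psi s * gw s)%:E)%E.
  under eq_integral do rewrite mulrDl mul1r EFinD.
  rewrite ge0_integralD//=.
  - by rewrite integral_gauss// mul1r.
  - by move=> x _; rewrite lee_fin gauss_ge0.
  - by move=> x _; rewrite lee_fin mulr_ge0 ?gauss_ge0 ?psi_ge0.
  - by apply/measurable_EFinP; exact: measurable_psi_gw.
have m1 z : measurable_fun [set: R] (fun s => (1 + cos (z * s + 0)) * gw s).
  apply: continuous_measurableT => x.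
  apply: (@continuousM _ _ (fun x => 1 + cos (z * x + 0))); last exact: continuous_gauss.
  apply: (@continuousD _ R^o); first exact: cst_continuous.
  apply: continuous_comp; last exact: continuous_cos.
  by apply: continuousD; [exact: mulrl_continuous|exact: cst_continuous].
have p1 z s : 0 <= (1 + cos (z * s + 0)) * gw s.
  by rewrite mulr_ge0 ?gauss_ge0// -lerBlDl sub0r cos_geN1.
have E2 : (\int[mu]_s ((1 + psi s) * gw s)%:E = (sq2pi + Kpsi)%:E)%E.
  transitivity (\int[mu]_s \sum_k \sum_l (q k * q l)%:E * ((1 + cos ((y k - y l) * s + 0)) * gw s)%:E)%E.
    apply: eq_integral => s _; rewrite psiE -{1}sum_qq -big_split mulr_suml -sumEFin.
    apply: eq_bigr => k _; rewrite -big_split mulr_suml -sumEFin.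
    by apply: eq_bigr => l _; rewrite addr0 -EFinM; congr EFin => /=; ring.
  rewrite ge0_integral_sum//.
  - under eq_bigr => k _.
      rewrite ge0_integral_sum//.
      + under eq_bigr => l _.
          rewrite ge0_integralZl//.
          * rewrite integral_1cos_gw cos0 mul1r -EFinM; over.
          * by apply/measurable_EFinP; exact: m1.
          * by move=> s _; rewrite lee_fin p1.
          * by rewrite lee_fin mulr_ge0.
        rewrite sumEFin; over.
      + by move=> l; apply/measurable_EFinP; apply: measurable_funM => //; exact: m1.
      + by move=> l s _; rewrite -EFinM lee_fin; apply: mulr_ge0; [exact: mulr_ge0|exact: p1].
    rewrite sumEFin; congr EFin.
    have -> : sq2pi + Kpsi = sq2pi * (\sum_k \sum_l q k * q l + \sum_k \sum_l q k * q l * gw (y k - y l)).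
      by rewrite sum_qq mulrDr mulr1.
    rewrite -big_split mulr_sumr; apply: eq_bigr => k _ /=.
    by rewrite -big_split mulr_sumr; apply: eq_bigr => l _ /=; ring.
  - move=> k; apply: emeasurable_sum => l.
    by apply/measurable_EFinP; apply: measurable_funM => //; exact: m1.
  - move=> k s _; apply: sume_ge0 => l _.
    by rewrite -EFinM lee_fin; apply: mulr_ge0; [exact: mulr_ge0|exact: p1].
have := congr1 (fun u => u - sq2pi%:E)%E E1.
by rewrite E2 EFinD [X in (X - _)%E = _ -> _]addeC [X in _ = (X - _)%E -> _]addeC !addeK.
Qed.

(** Condition on one of the two copies: the other is concentrated around it, and [gw] lies below the
    wider Gaussian [gauss 2]. *)
Lemma Kpsi_le : Kpsi <= sq2pi * (4 * expR 2 * p).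
Proof.
rewrite ler_wpM2l ?sqrtr_ge0//.
have p0 : 0 <= p by apply: le_trans (qp 0); rewrite sumr_ge0.
have -> : 4 * expR 2 * p = \sum_k q k * (4 * expR 2 * p) by rewrite -mulr_suml q1 mul1r.
apply: ler_sum => k _.
under eq_bigr do rewrite -mulrA.
rewrite -mulr_sumr ler_wpM2l//; apply: le_trans (sum_gauss2_le (y k)).
apply: ler_sum => l _; rewrite ler_wpM2l// -gaussN opprB /gauss ler_expR lerN2.
by rewrite ler_wpM2l ?sqr_ge0// lef_pV2 ?posrE//; lra.
Qed.

(** In what follows r^2 stands for 1 / c. [H r] is what remains of psi^(r^2 / 2) exp (- r^2 s^2 / 2)
    once one factor psi is set aside and ln psi <= - D is used. [ind] selects the region psi >= 1/2,
    the only one where decay in D alone does not suffice; the goal is r I(r) = O([Kpsi]) uniformly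
    in r. *)
Let D (s : R) : R := 1 - psi s.
Let D0 s : 0 <= D s. Proof. by rewrite subr_ge0 psi_le1. Qed.
Let H (r s : R) : R := expR (- (r ^+ 2 * (D s / 4 + s ^+ 2 / 2))).
Let ind (s : R) : R := if D s <= 2^-1 then 1 else 0.
Let ind0 s : 0 <= ind s. Proof. by rewrite /ind; case: ifP. Qed.
Let I (r : R) : \bar R := (\int[mu]_s (ind s * H r s)%:E)%E.

Let measurable_D : measurable_fun setT D.
Proof. by apply: measurable_funB => //; exact: measurable_psi. Qed.

Let measurable_H r : measurable_fun setT (H r).
Proof.
apply: (@measurableT_comp _ _ _ _ _ _ (@expR R)) => //.
apply: measurable_funN; apply: measurable_funM => //.
apply: measurable_funD; first by apply: measurable_funM.
by apply: measurable_funM => //; exact: exprn_measurable.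
Qed.

Let measurable_ind : measurable_fun setT ind.
Proof.
apply: measurable_fun_ifT => //; exact: measurable_fun_ler.
Qed.

Let measurable_I r : measurable_fun setT (fun s => (ind s * H r s)%:E).
Proof. by apply/measurable_EFinP; apply: measurable_funM. Qed.

Let I_ge0 r s : (0 <= (ind s * H r s)%:E)%E.
Proof. by rewrite lee_fin; apply: mulr_ge0 => //; exact: expR_ge0. Qed.

Lemma Kpsi_ge0 : 0 <= Kpsi.
Proof. by rewrite -lee_fin -integral_psi; apply: integral_ge0 => s _; rewrite lee_fin mulr_ge0 ?psi_ge0 ?gauss_ge0. Qed.

Let ind_le_psi s : ind s <= 2 * psi s.
Proof.
rewrite /ind; have [d|d] := leP (D s) 2^-1; first by move: d; rewrite /D; lra.
by rewrite mulr_ge0// psi_ge0.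
Qed.

Let H_le_gw r s : 1 <= r -> H r s <= gw s.
Proof.
move=> r1; rewrite /H gwE ler_expR lerN2.
have r2 : 1 <= r ^+ 2 by exact: exprn_ege1.
have := D0 s; have := sqr_ge0 s; set u := s ^+ 2; set v := D s; nra.
Qed.

Let I_base r : 1 <= r -> (I r <= (2 * Kpsi)%:E)%E.
Proof.
move=> r1; rewrite EFinM -integral_psi -ge0_integralZl//.
- apply: ge0_le_integral => //.
  + exact: measurable_I.
  + by apply/measurable_EFinP; apply: measurable_funM => //; exact: measurable_psi_gw.
  + move=> s _; rewrite -EFinM lee_fin mulrA ler_pM// ?expR_ge0//; exact: H_le_gw.
- by apply/measurable_EFinP; exact: measurable_psi_gw.
- by move=> s _; rewrite lee_fin mulr_ge0 ?psi_ge0 ?gauss_ge0.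
Qed.

Lemma expN_le_inv x : 0 < x -> expR (- x) <= x^-1 :> R.
Proof.
move=> x0; rewrite expRN lef_pV2 ?posrE ?expR_gt0//.
by apply: le_trans (expR_ge1Dx x); rewrite lerDr.
Qed.

(* [D (2 s) <= 4 D s] makes the dilation by 2 nearly preserve the integrand when [r] is halved *)
Let I_step r : 2 <= r -> (r%:E * I r <= (r / 2)%:E * I (r / 2) + (64 / r * Kpsi)%:E)%E.
Proof.
move=> r2; have r0 : 0 < r by lra.
have half : (I (r / 2) = 2%:E * \int[mu]_s (ind (2 * s) * H (r / 2) (2 * s))%:E)%E.
  have := @ge0_integral_affine R 2 0 _ (lt0r_neq0 (ltr0n R 2)) (measurable_I (r / 2)) (I_ge0 (r / 2)).
  under eq_integral do rewrite addr0.
  move=> ->.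
  by rewrite ger0_norm// muleA -EFinM mulfV// mul1e.
have m2 : measurable_fun setT (fun s : R => (ind (2 * s) * H (r / 2) (2 * s))%:E).
  by apply: (measurableT_comp (measurable_I (r / 2))); exact: mulrl_measurable.
have e0 : 0 <= expR (- (r ^+ 2 / 32)) * 2 by rewrite mulr_ge0// expR_ge0.
(* If D(2s) <= 1/2, the exponents compare directly. Otherwise D(s) >= D(2s) / 4 > 1/8, so H gains
   exp (- r^2 / 32) and still leaves [gw s], while 1 <= 2 psi(s) on the region selected by [ind]. *)
have pw s : ind s * H r s <= ind (2 * s) * H (r / 2) (2 * s) +
   expR (- (r ^+ 2 / 32)) * 2 * (psi s * gw s).
  have t0 : 0 <= expR (- (r ^+ 2 / 32)) * 2 * (psi s * gw s).
    by apply: mulr_ge0 => //; apply: mulr_ge0; [exact: psi_ge0|exact: gauss_ge0].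
  rewrite {1}/ind; have [d1|d1] := leP (D s) 2^-1; last first.
    by rewrite mul0r; apply: addr_ge0 => //; apply: mulr_ge0 => //; exact: expR_ge0.
  have D2 : D (2 * s) <= 4 * D s by exact: one_sub_psi2.
  rewrite mul1r /ind; have [d2|d2] := leP (D (2 * s)) 2^-1.
    rewrite mul1r ler_wpDr//.
    rewrite /H ler_expR lerN2 !exprMn exprVn.
    have := sqr_ge0 r; set u := r ^+ 2; set v := s ^+ 2 => u0; nra.
  rewrite mul0r add0r -mulrA [2 * _]mulrA; apply: (@le_trans _ _ (expR (- (r ^+ 2 / 32)) * gw s)).
    rewrite gwE -expRD ler_expR -opprD lerN2.
    have : 4 <= r ^+ 2 by nra.
    have := sqr_ge0 s; set u := r ^+ 2; set v := s ^+ 2 => v0 u4; nra.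
  rewrite ler_wpM2l ?expR_ge0// ler_peMl ?gauss_ge0//.
  by move: d1; rewrite /D; lra.
have le1 : (I r <= 2^-1%:E * I (r / 2) + (expR (- (r ^+ 2 / 32)) * 2 * Kpsi)%:E)%E.
  rewrite half muleA -EFinM mulVf// mul1e EFinM -integral_psi -ge0_integralZl//; last 2 first.
  - by apply/measurable_EFinP; exact: measurable_psi_gw.
  - by move=> s _; rewrite lee_fin mulr_ge0 ?psi_ge0 ?gauss_ge0.
  have f20 s : (0 <= (expR (- (r ^+ 2 / 32)) * 2)%:E * (psi s * gw s)%:E)%E.
    by rewrite -EFinM lee_fin (mulr_ge0 e0)// mulr_ge0 ?psi_ge0 ?gauss_ge0.
  have mf2 : measurable_fun setT (fun s => (expR (- (r ^+ 2 / 32)) * 2)%:E * (psi s * gw s)%:E)%E.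
    by apply/measurable_EFinP; apply: measurable_funM => //; exact: measurable_psi_gw.
  rewrite -(@ge0_integralD _ _ _ mu setT measurableT _ _ (fun s _ => I_ge0 (r / 2) (2 * s)) m2 (fun s _ => f20 s) mf2).
  apply: ge0_le_integral => //; first exact: measurable_I.
  - exact: emeasurable_funD.
  - by move=> s _; rewrite -EFinM -EFinD lee_fin.
apply: (@le_trans _ _ (r%:E * (2^-1%:E * I (r / 2) + (expR (- (r ^+ 2 / 32)) * 2 * Kpsi)%:E))%E).
  by rewrite lee_pmul2l// ?fin_numE// lte_fin.
rewrite muleDr//; last first.
  by rewrite ge0_adde_def// inE ?mule_ge0// ?lee_fin ?(mulr_ge0 e0) ?Kpsi_ge0//; apply: integral_ge0.
rewrite muleA -EFinM leeD2l// -EFinM lee_fin mulrA ler_wpM2r ?Kpsi_ge0//.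
(* The error is r * 2 exp (- r^2 / 32) <= r * 2 * 32 / r^2 = 64 / r. *)
have := @expN_le_inv (r ^+ 2 / 32); rewrite divr_gt0 ?exprn_gt0// => /(_ isT) hh.
rewrite mulrA; apply: (@le_trans _ _ (r * (r ^+ 2 / 32)^-1 * 2)).
  by rewrite ler_wpM2r// ler_wpM2l// ltW.
rewrite invf_div le_eqVlt; apply/orP; left; apply/eqP; field; lra.
Qed.

(* The error [64 / r] telescopes as [64 / (r / 2) - 64 / r]; [68] makes the bound at least [4 >= 2 * r] in the base case [1 <= r <= 2] *)
Let I_bound n r : 1 <= r -> r <= 2 ^+ n.+1 -> (r%:E * I r <= ((68 - 64 / r) * Kpsi)%:E)%E.
Proof.
elim: n r => [|n IH] r r1 rn.
  have r2 : r <= 2 := rn.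
  have r0 : 0 < r by lra.
  apply: (@le_trans _ _ (r%:E * (2 * Kpsi)%:E)%E).
    by rewrite lee_pmul2l ?lte_fin//; exact: I_base.
  rewrite -EFinM lee_fin mulrA ler_wpM2r ?Kpsi_ge0//.
  have : r^-1 <= 1 by rewrite invf_le1.
  lra.
have [r2|r2] := leP r 2; first apply: IH => //.
  by apply: (le_trans r2); apply: ler_eXnr => //; rewrite ler1n.
apply: le_trans (I_step (ltW r2)) _.
have h1 : 1 <= r / 2 by lra.
have h2 : r / 2 <= 2 ^+ n.+1 by move: rn; rewrite exprS; lra.
apply: le_trans (leeD2r _ (IH _ h1 h2)) _.
rewrite -EFinD lee_fin -mulrDl ler_wpM2r ?Kpsi_ge0//.
by rewrite invf_div; lra.
Qed.

(** Outside the region of [ind], D > 1/2 gives H(s) <= exp (- r^2 / 8) gw(s), which contributes at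
    most r * (8 / r^2) <= 8 times [Kpsi]. Adding the 68 from [I_bound] gives 76. *)
Let J_bound r : 2 <= r ->
  (r%:E * \int[mu]_s (psi s * H r s)%:E <= (76 * Kpsi)%:E)%E.
Proof.
move=> r2; have r0 : 0 < r by lra.
have e0 : 0 <= expR (- (r ^+ 2 / 8)) by exact: expR_ge0.
have mJ : measurable_fun setT (fun s : R => psi s * H r s).
  by apply: measurable_funM => //; exact: measurable_psi.
have Jle : (\int[mu]_s (psi s * H r s)%:E <= I r + (expR (- (r ^+ 2 / 8)) * Kpsi)%:E)%E.
  rewrite EFinM -integral_psi -ge0_integralZl//; last 2 first.
  - by apply/measurable_EFinP; exact: measurable_psi_gw.
  - by move=> s _; rewrite lee_fin mulr_ge0 ?psi_ge0 ?gauss_ge0.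
  have f20 s : (0 <= (expR (- (r ^+ 2 / 8)))%:E * (psi s * gw s)%:E)%E.
    by rewrite -EFinM lee_fin (mulr_ge0 e0)// mulr_ge0 ?psi_ge0 ?gauss_ge0.
  have mf2 : measurable_fun setT (fun s => (expR (- (r ^+ 2 / 8)))%:E * (psi s * gw s)%:E)%E.
    by apply/measurable_EFinP; apply: measurable_funM => //; exact: measurable_psi_gw.
  rewrite -(@ge0_integralD _ _ _ mu setT measurableT _ _ (fun s _ => I_ge0 r s) (measurable_I r) (fun s _ => f20 s) mf2).
  apply: ge0_le_integral => //.
  - by move=> s _; rewrite lee_fin mulr_ge0 ?psi_ge0 ?expR_ge0.
  - exact/measurable_EFinP.
  - by apply: emeasurable_funD => //; exact: measurable_I.
  - move=> s _; rewrite -EFinM -EFinD lee_fin.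
    rewrite /ind; have [d|d] := leP (D s) 2^-1.
      rewrite mul1r; apply: ler_wpDr.
        by apply: mulr_ge0 => //; apply: mulr_ge0; [exact: psi_ge0|exact: gauss_ge0].
      by rewrite ler_piMl ?expR_ge0// psi_le1.
    rewrite mul0r add0r mulrCA ler_wpM2l ?psi_ge0// gwE -expRD ler_expR -opprD lerN2.
    have := sqr_ge0 s; have : 4 <= r ^+ 2 by nra.
    set u := r ^+ 2; set v := s ^+ 2 => u4 v0; nra.
have hI : (r%:E * I r <= (68 * Kpsi)%:E)%E.
  have [n hn] : exists n, r <= 2 ^+ n.+1.
    exists (Num.trunc r); apply: ltW.
    have /andP[_ t2] := Num.Theory.trunc_itv (ltW r0).
    by apply: (lt_trans t2); rewrite -natrX ltr_nat ltn_expl.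
  apply: (le_trans (I_bound _ hn)); first lra.
  by rewrite lee_fin ler_wpM2r ?Kpsi_ge0// gerBl divr_ge0// ltW.
apply: (@le_trans _ _ (r%:E * (I r + (expR (- (r ^+ 2 / 8)) * Kpsi)%:E))%E).
  by rewrite lee_pmul2l// lte_fin.
rewrite muleDr//; last first.
  by rewrite ge0_adde_def// inE ?lee_fin ?(mulr_ge0 e0) ?Kpsi_ge0//; apply: integral_ge0 => s _; exact: I_ge0.
apply: (@le_trans _ _ ((68 * Kpsi)%:E + (8 * Kpsi)%:E)%E); last first.
  by rewrite -EFinD lee_fin; lra.
apply: leeD => //; rewrite -EFinM lee_fin mulrA ler_wpM2r ?Kpsi_ge0//.
have := @expN_le_inv (r ^+ 2 / 8); rewrite divr_gt0 ?exprn_gt0// => /(_ isT) hh.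
apply: (@le_trans _ _ (r * (r ^+ 2 / 8)^-1)); first by rewrite ler_wpM2l// ltW.
rewrite invf_div.
have -> : r * (8 / r ^+ 2) = 8 * r^-1 by field; lra.
by rewrite ler_piMr// invf_le1//; lra.
Qed.

(** With x = 1 / c >= 4, psi^(x/2) = psi psi^(x/2 - 1) <= psi exp (- (x/2 - 1) D), and x/2 - 1 >=
    x/4. This bounds the integrand by psi [H r] with r = 1 / sqrt c >= 2. *)
Lemma integral_psi_powR c : 0 < c -> c <= 4^-1 ->
  (\int[mu]_s ((psi s `^ (2 * c)^-1) * expR (- (s ^+ 2 / (2 * c))))%:E <=
   (76 * Kpsi * Num.sqrt c)%:E)%E.
Proof.
move=> c0 c4; pose r := (Num.sqrt c)^-1.
have sc0 : 0 < Num.sqrt c by rewrite sqrtr_gt0.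
have rc : r ^+ 2 = c^-1 by rewrite exprVn sqr_sqrtr// ltW.
have r2 : 2 <= r.
  rewrite -(@ler_pXn2r _ 2) ?nnegrE ?invr_ge0 ?(ltW sc0)// rc -natrX.
  by rewrite -[leLHS]invrK lef_pV2 ?posrE ?invr_gt0.
have r0 : 0 < r by lra.
have mJ : measurable_fun setT (fun s : R => psi s * H r s).
  by apply: measurable_funM => //; exact: measurable_psi.
have pw s : psi s `^ (2 * c)^-1 * expR (- (s ^+ 2 / (2 * c))) <= psi s * H r s.
  have [p0|p0] := eqVneq (psi s) 0.
    rewrite p0 powR0 ?mul0r// invr_eq0 mulf_eq0 negb_or gt_eqF//=; lra.
  have pp : 0 < psi s by rewrite lt_neqAle eq_sym p0 psi_ge0.
  rewrite /powR (negbTE p0) -[X in X * H r s](lnK pp) /H rc -!expRD ler_expR.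
  have lnp : ln (psi s) <= - D s by have := expR_ge1Dx (ln (psi s)); rewrite lnK// /D; lra.
  have x4 : 4 <= c^-1 by rewrite -[leLHS]invrK lef_pV2 ?posrE ?invr_gt0.
  rewrite invfM; set x := c^-1 in x4 *; set L := ln (psi s) in lnp *; set v := s ^+ 2.
  have := D0 s; set e := D s in lnp * => De.
  have : (x / 2 - 1) * L <= (x / 2 - 1) * - e by rewrite ler_wpM2l//; lra.
  have : 0 <= (x / 4 - 1) * e by rewrite mulr_ge0//; lra.
  lra.
have Jfin : (\int[mu]_s (psi s * H r s)%:E <= (r^-1)%:E * (76 * Kpsi)%:E)%E.
  have := J_bound r2; rewrite -(@lee_pmul2l _ r^-1%:E)//; last by rewrite lte_fin invr_gt0.
  by rewrite muleA -EFinM mulVf ?gt_eqF// mul1e.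
have -> : 76 * Kpsi * Num.sqrt c = r^-1 * (76 * Kpsi) by rewrite invrK mulrC.
rewrite EFinM; apply: le_trans Jfin; apply: ge0_le_integral => //.
- by move=> s _; rewrite lee_fin; apply: mulr_ge0; [exact: powR_ge0|exact: expR_ge0].
- apply/measurable_EFinP; apply: measurable_funM.
    by apply: (measurableT_comp (@measurable_powR R _)); exact: measurable_psi.
  apply: (@measurableT_comp _ _ _ _ _ _ (@expR R)) => //.
  by apply: measurable_funN; apply: measurable_funM => //; exact: exprn_measurable.
- exact/measurable_EFinP.
- by move=> s _; rewrite lee_fin; exact: pw.
Qed.

End conc.
End oned.

(** * Determinantal weights and AM-GM *)

Section determinantal.
Context {R : realType} (d n : nat) (U : 'M[R]_(d, n)).
Hypothesis orthoU : U *m U^T = 1%:M.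

Definition csq i : R := \sum_k U k i ^+ 2.
(* By Cauchy-Binet, [detg g ^+ 2 / d`!] is a probability on d-tuples of columns of [U]; its intensity is [csq] *)
Definition detg (g : {ffun 'I_d -> 'I_n}) : R := \det (\matrix_(j, k) U k (g j)).

Lemma csq_ge0 i : 0 <= csq i. Proof. by apply: sumr_ge0 => k _; rewrite sqr_ge0. Qed.

Lemma row_ortho a b : \sum_i U a i * U b i = (a == b)%:R.
Proof.
have := congr1 (fun M : 'M[R]_d => M a b) orthoU; rewrite !mxE => <-.
by apply: eq_bigr => i _; rewrite mxE.
Qed.

Lemma sum_csq : \sum_i csq i = d%:R.
Proof.
rewrite exchange_big (eq_bigr (fun=> 1)) => [|k _].
  by rewrite sumr_const card_ord.
by under eq_bigr do rewrite expr2; rewrite row_ortho eqxx.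
Qed.

(** Leibniz expansion of both determinants, then exchange of the sum over tuples with the product
    over slots. A weight per slot allows both the total mass (all weights 1) and the marginals (one
    nontrivial weight) to be extracted. *)
Lemma sum_detg2 (w : 'I_d -> 'I_n -> R) :
  \sum_g detg g ^+ 2 * \prod_j w j (g j) =
  \sum_(s : 'S_d) \sum_(t : 'S_d) (-1) ^+ s * (-1) ^+ t *
    \prod_j \sum_i U (s j) i * U (t j) i * w j i.
Proof.
transitivity (\sum_(g : {ffun 'I_d -> 'I_n}) \sum_(s : 'S_d) \sum_(t : 'S_d) (-1) ^+ s * (-1) ^+ t *
    \prod_j (U (s j) (g j) * U (t j) (g j) * w j (g j))).
  apply: eq_bigr => g _; rewrite /detg expr2 /determinant big_distrlr /= mulr_suml.
  apply: eq_bigr => s _; rewrite mulr_suml; apply: eq_bigr => t _.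
  rewrite mulrACA -!mulrA; congr (_ * (_ * _)).
  by rewrite mulrA -!big_split; apply: eq_bigr => j _; rewrite !mxE.
rewrite exchange_big; apply: eq_bigr => s _; rewrite exchange_big; apply: eq_bigr => t _.
by rewrite -mulr_sumr (bigA_distr_bigA (fun j i => U (s j) i * U (t j) i * w j i)).
Qed.

(** Orthonormality of the rows forces s j = t j in every slot other than [j0], and permutations that
    agree off one point are equal. Only the diagonal s = t survives. *)
Lemma sum_detg2_marginal (h : 'I_n -> R) (j0 : 'I_d) :
  \sum_g detg g ^+ 2 * h (g j0) = \sum_(s : 'S_d) \sum_i U (s j0) i ^+ 2 * h i.
Proof.
pose w j i := if j == j0 then h i else 1.
transitivity (\sum_g detg g ^+ 2 * \prod_j w j (g j)).
  apply: eq_bigr => g _; congr (_ * _).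
  rewrite (bigD1 j0)//= {1}/w eqxx big1 ?mulr1// => j jj0.
  by rewrite /w (negbTE jj0).
rewrite sum_detg2; apply: eq_bigr => s _.
rewrite (bigD1 s)//= [X in _ + X]big1 ?addr0 => [|t ts].
  rewrite -signr_addb addbb mul1r (bigD1 j0)//= [X in _ * X]big1 ?mulr1 => [|j jj0].
    by apply: eq_bigr => i _; rewrite /w eqxx expr2.
  by rewrite (eq_bigr (fun i => U (s j) i * U (s j) i)) ?row_ortho ?eqxx// => i _; rewrite /w (negbTE jj0) mulr1.
have [j jj0 stj] : exists2 j, j != j0 & s j != t j.
  apply/exists_inP; apply: contraNT ts => /exists_inPn H.
  have E j : j != j0 -> s j = t j by move=> /H; rewrite negbK => /eqP.
  apply/eqP/permP => j; have [->|/E//] := eqVneq j j0.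
  have [k sk] : exists k, s k = t j0 by exists ((s^-1)%g (t j0)); rewrite permKV.
  have [k0|k0] := eqVneq k j0; first by rewrite -sk k0.
  by move: (E _ k0); rewrite sk => /perm_inj k0'; rewrite k0' eqxx in k0.
rewrite (bigD1 j)//= (eq_bigr (fun i => U (s j) i * U (t j) i)) => [|i _]; last first.
  by rewrite /w (negbTE jj0) mulr1.
by rewrite row_ortho (negbTE stj) mul0r mulr0.
Qed.

(** For fixed s, the row s j runs through all rows as j varies, so the marginals add up to [csq],
    once for each of the d! permutations. *)
Lemma sum_detg2_sum (h : 'I_n -> R) :
  \sum_g detg g ^+ 2 * \sum_j h (g j) = d`!%:R * \sum_i csq i * h i.
Proof.
under eq_bigr do rewrite mulr_sumr.
rewrite exchange_big /=.
under eq_bigr do rewrite sum_detg2_marginal.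
rewrite exchange_big /= (eq_bigr (fun=> \sum_i csq i * h i)) => [|s _].
  by rewrite sumr_const card_Sn mulr_natl.
rewrite exchange_big; apply: eq_bigr => i _ /=.
by rewrite -mulr_suml /csq [in RHS](reindex_inj (@perm_inj _ s)).
Qed.

Lemma sum_detg2_1 : \sum_g detg g ^+ 2 = d`!%:R.
Proof.
have := sum_detg2 (fun _ _ => 1); set S := LHS.
have -> : S = \sum_g detg g ^+ 2 by apply: eq_bigr => g _; rewrite big1 ?mulr1.
move=> ->; rewrite (eq_bigr (fun=> 1)) => [|s _].
  by rewrite sumr_const card_Sn.
have E (t : 'S_d) : \prod_j \sum_i U (s j) i * U (t j) i * 1 = (s == t)%:R.
  have [->|st] := eqVneq s t.
    apply: big1 => j _; rewrite (eq_bigr (fun i => U (t j) i * U (t j) i)) ?row_ortho ?eqxx// => i _.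
    by rewrite mulr1.
  have /existsP[j stj] : [exists j, s j != t j].
    apply: contraNT st => /existsPn H; apply/eqP/permP => j.
    by have := H j; rewrite negbK => /eqP.
  rewrite (bigD1 j)//= (eq_bigr (fun i => U (s j) i * U (t j) i)) ?row_ortho ?(negbTE stj) ?mul0r// => i _.
  by rewrite mulr1.
rewrite (bigD1 s)//= E eqxx mulr1 -signr_addb addbb big1 ?addr0// => t ts.
by rewrite E eq_sym (negbTE ts) mulr0.
Qed.

Lemma detg_csq0 (g : {ffun 'I_d -> 'I_n}) j : csq (g j) = 0 -> detg g = 0.
Proof.
move=> c0; rewrite /detg (expand_det_row _ j) big1// => k _; rewrite mxE.
have /eqP := c0; rewrite psumr_eq0 => [/allP/(_ k)|i _]; last exact: sqr_ge0.
by rewrite mem_index_enum => /(_ isT); rewrite sqrf_eq0 => /eqP ->; rewrite mul0r.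
Qed.

Lemma sum_prod_csq : \sum_(g : {ffun 'I_d -> 'I_n}) \prod_j csq (g j) = d%:R ^+ d.
Proof. by rewrite -(bigA_distr_bigA (fun _ i => csq i)) /= prodr_const card_ord sum_csq. Qed.

End determinantal.

Section amgm.
Context {R : realType}.

(** Average the tangent line of the exponential at the mean m: exp x >= exp m (1 + x - m). *)
Lemma expR_Jensen (I : finType) (a x : I -> R) : (forall i, 0 <= a i) -> \sum_i a i = 1 ->
  expR (\sum_i a i * x i) <= \sum_i a i * expR (x i).
Proof.
move=> a0 a1; set m := \sum_i a i * x i.
have -> : expR m = \sum_i a i * (expR m * (1 + (x i - m))).
  transitivity (expR m * (\sum_i a i + (\sum_i a i * x i - (\sum_i a i) * m))).
    by rewrite a1 mul1r subrr addr0 mulr1.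
  rewrite mulr_suml -sumrB -big_split mulr_sumr; apply: eq_bigr => i _ /=; ring.
apply: ler_sum => i _; rewrite ler_wpM2l//.
have -> : expR (x i) = expR m * expR (x i - m) by rewrite -expRD addrC subrK.
by rewrite ler_wpM2l ?expR_ge0// expR_ge1Dx.
Qed.

(** The induction step is (1 + 1/k)^k <= e with k = d + 1; since k must be positive, 0 and 1 are
    both base cases. *)
Lemma pow_fact_le (d : nat) : d%:R ^+ d <= d`!%:R * expR d%:R :> R.
Proof.
elim: d => [|[|d] IH]; first by rewrite expr0 fact0 mul1r expR0.
  by rewrite expr1 (_ : 1`! = 1%N)// mul1r (le_trans _ (expR_ge1Dx 1))// lerDl.
have e1 : d.+2%:R ^+ d.+1 <= expR 1 * d.+1%:R ^+ d.+1 :> R.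
  have -> : expR 1 = expR (d.+1%:R^-1) ^+ d.+1 :> R by rewrite -expRM_natl mulfV.
  rewrite -exprMn lerXn2r ?nnegrE ?mulr_ge0 ?expR_ge0//.
  rewrite (_ : d.+2%:R = (1 + d.+1%:R^-1) * d.+1%:R); last first.
    by rewrite mulrDl mul1r mulVf// natr1.
  by rewrite ler_wpM2r// expR_ge1Dx.
rewrite exprS factS natrM -mulrA ler_wpM2l//.
apply: (le_trans e1); rewrite -[in expR d.+2%:R]natr1 expRD mulrA [leRHS]mulrC.
by rewrite ler_wpM2l ?expR_ge0.
Qed.

Lemma fact_gt0R (d : nat) : 0 < d`!%:R :> R. Proof. by rewrite ltr0n fact_gt0. Qed.

(** Weighted AM-GM: the intensity condition applied to h = L / c rewrites the sum of L as an average
    over J, and Jensen applies. Where c i = 0 the quotient is 0 by convention, consistently with L i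
    = 0. *)
Lemma expR_sum_le (I J : finType) (a : J -> R) (c L : I -> R) (S : J -> (I -> R) -> R) :
  (forall j, 0 <= a j) -> \sum_j a j = 1 ->
  (forall h, \sum_j a j * S j h = \sum_i c i * h i) -> (forall i, c i = 0 -> L i = 0) ->
  expR (\sum_i L i) <= \sum_j a j * expR (S j (fun i => L i / c i)).
Proof.
move=> a0 a1 aS L0; apply: le_trans (expR_Jensen _ a0 a1).
rewrite ler_expR le_eqVlt; apply/orP; left; apply/eqP.
rewrite aS; apply: eq_bigr => i _; have [c0|c0] := eqVneq (c i) 0.
  by rewrite c0 mul0r L0.
by rewrite mulrCA mulfV// mulr1.
Qed.

End amgm.

(** * Characteristic function of a product law *)

Section fourier.
Context {R : realType} (n K : nat) (q : 'I_n -> 'I_K -> R) (y : 'I_K -> R).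

(* The modulus of a product of independent characteristic functions, read off in [R[i]] *)
Lemma sum_cos_le (s : 'I_n -> R) (b : R) :
  \sum_(f : {ffun 'I_n -> 'I_K}) (\prod_i q i (f i)) * cos (\sum_i s i * y (f i) + b) <=
  \prod_i Num.sqrt ((\sum_k q i k * cos (s i * y k)) ^+ 2 + (\sum_k q i k * sin (s i * y k)) ^+ 2).
Proof.
pose e (x : R) : R[i] := (cos x +i* sin x)%C.
have eD x z : e (x + z) = e x * e z.
  by rewrite /e cosD sinD; simpc; rewrite [sin x * _ + _]addrC.
have e_sum (I : finType) (g : I -> R) : e (\sum_i g i) = \prod_i e (g i).
  by apply: (big_morph e eD); rewrite /e cos0 sin0.
have eZ (a x : R) : (a%:C)%C * e x = (a * cos x +i* (a * sin x))%C by rewrite /e; simpc.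
have csum (I : finType) (u v : I -> R) :
    \sum_i (u i +i* v i)%C = ((\sum_i u i) +i* (\sum_i v i))%C.
  elim: (index_enum I) => [|i r IH]; first by rewrite !big_nil.
  by rewrite !big_cons IH; simpc.
have e_norm x : `|e x| = 1 by rewrite normc_def /= cos2Dsin2 sqrtr1.
pose al f := \sum_i s i * y (f i) + b.
(* Independence factorises the complex expectation, and the phase [b] contributes a factor of
   modulus 1. The cosine sum is its real part, hence at most its modulus. *)
have E : \sum_(f : {ffun 'I_n -> 'I_K}) ((\prod_i q i (f i))%:C)%C * e (al f) =
   e b * \prod_i \sum_k ((q i k)%:C)%C * e (s i * y k).
  rewrite (bigA_distr_bigA (fun i k => ((q i k)%:C)%C * e (s i * y k))) mulr_sumr.
  apply: eq_bigr => f _; rewrite /al addrC eD e_sum rmorph_prod mulrCA.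
  by congr (_ * _); rewrite -big_split.
have := congr1 Num.norm E.
rewrite normrM e_norm mul1r normr_prod.
have csumZ (I : finType) (u x : I -> R) : \sum_i ((u i)%:C)%C * e (x i) =
    ((\sum_i u i * cos (x i)) +i* (\sum_i u i * sin (x i)))%C.
  by rewrite -csum; apply: eq_bigr => i _; rewrite eZ.
rewrite csumZ normc_def /=.
rewrite [X in _ = X -> _](eq_bigr (fun i => (Num.sqrt ((\sum_k q i k * cos (s i * y k)) ^+ 2 +
  (\sum_k q i k * sin (s i * y k)) ^+ 2))%:C%C)); last first.
  by move=> i _; rewrite csumZ normc_def.
rewrite -rmorph_prod => -[<-].
by apply: le_trans (ler_norm _) _; rewrite -sqrtr_sqr ler_wsqrtr// lerDl sqr_ge0.
Qed.

End fourier.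

(** * Projections with small diagonal *)

Lemma prode_le (R : realType) (I : finType) (a b : I -> \bar R) :
  (forall i, 0 <= a i)%E -> (forall i, a i <= b i)%E -> (\prod_i a i <= \prod_i b i)%E.
Proof.
move=> a0 ab; suff: (0 <= \prod_i a i)%E && (\prod_i a i <= \prod_i b i)%E by case/andP.
apply: (big_ind2 (fun x y => (0 <= x)%E && (x <= y)%E)) => [|x1 y1 x2 y2 /andP[? ?] /andP[? ?]|i _].
- by rewrite lexx lee01.
- by rewrite mule_ge0//= lee_pmul.
- by rewrite a0 ab.
Qed.

Section small.
Context {R : realType} (d n K : nat) (U : 'M[R]_(d, n)).
Notation mu := (@lebesgue_measure R).
Notation gw := (gauss (1 : R)).
Notation sq2pi := (Num.sqrt (pi *+ 2) : R).
Hypothesis orthoU : U *m U^T = 1%:M.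
Variables (q : 'I_n -> 'I_K -> R) (y : 'I_K -> R) (p : R).
Hypothesis q0 : forall i k, 0 <= q i k.
Hypothesis q1 : forall i, \sum_k q i k = 1.
Hypothesis qp : forall i x, \sum_(k | `|y k - x| <= 1) q i k <= p.
Hypothesis c4 : forall i, csq U i <= 4^-1.

Let c := csq U.
Let lg (g : {ffun 'I_d -> 'I_n}) : R := detg U g ^+ 2 / d`!%:R.
(** The power 1 / c_i of |phi_i(s)| exp (- s^2 / 2), that is, the factor AM-GM attaches to column
    i. *)
Let F i (s : R) : R := psi (q i) y s `^ (2 * c i)^-1 * expR (- (s ^+ 2 / (2 * c i))).

Let F0 i s : 0 <= F i s. Proof. by apply: mulr_ge0; [exact: powR_ge0|exact: expR_ge0]. Qed.

Let mF i : measurable_fun setT (F i).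
Proof.
apply: measurable_funM.
  by apply: (measurableT_comp (@measurable_powR R _)); exact: measurable_psi.
apply: (@measurableT_comp _ _ _ _ _ _ (@expR R)) => //.
by apply: measurable_funN; apply: measurable_funM => //; exact: exprn_measurable.
Qed.

Let lg0 g : 0 <= lg g. Proof. by rewrite divr_ge0 ?sqr_ge0. Qed.

Let lg1 : \sum_g lg g = 1.
Proof. by rewrite -mulr_suml sum_detg2_1// divff// gt_eqF// fact_gt0R. Qed.

Let lgS h : \sum_g lg g * (\sum_j h (g j)) = \sum_i c i * h i.
Proof.
under eq_bigr do rewrite mulrAC.
by rewrite -mulr_suml sum_detg2_sum// mulrAC divff ?mul1r// gt_eqF// fact_gt0R.
Qed.

Let psi_at0 i : psi (q i) y 0 = 1.
Proof.
rewrite /psi [X in X ^+ 2 + _](_ : _ = 1) ?[X in _ + X ^+ 2](_ : _ = 0) ?expr1n ?expr0n ?addr0//.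
  by rewrite big1// => k _; rewrite mul0r sin0 mulr0.
by rewrite -(q1 i); apply: eq_bigr => k _; rewrite mul0r cos0 mulr1.
Qed.

(** If some psi vanishes the left side is 0; otherwise take logarithms and apply [expR_sum_le]. At a
    null column s i = 0, so psi = 1 and its logarithm vanishes as required. *)
Let prod_sqrt_psi_le (s : 'I_n -> R) : (forall i, c i = 0 -> s i = 0) ->
  \prod_i Num.sqrt (psi (q i) y (s i)) * expR (- (\sum_i s i ^+ 2 / 2)) <=
  \sum_g lg g * \prod_j F (g j) (s (g j)).
Proof.
move=> cs; have [/existsP[i /eqP i0]|/existsPn pn0] := boolP [exists i, psi (q i) y (s i) == 0].
  rewrite (bigD1 i)//= i0 sqrtr0 !mul0r; apply: sumr_ge0 => g _.
  by apply: mulr_ge0 => //; apply: prodr_ge0.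
have pp i : 0 < psi (q i) y (s i) by rewrite lt_neqAle eq_sym pn0 psi_ge0.
pose L i := ln (psi (q i) y (s i)) / 2 - s i ^+ 2 / 2.
have FE i : F i (s i) = expR (L i / c i).
  rewrite /F /powR (negbTE (pn0 i)) -expRD; congr expR.
  by rewrite /L !invfM; ring.
have -> : \prod_i Num.sqrt (psi (q i) y (s i)) * expR (- (\sum_i s i ^+ 2 / 2)) = expR (\sum_i L i).
  rewrite /L sumrB expRD expR_sum; congr (_ * _); apply: eq_bigr => i _.
  by rewrite -powR12_sqrt ?psi_ge0// /powR (negbTE (pn0 i)) mulrC.
have := expR_sum_le (L := L) lg0 lg1 lgS; move=> /(_ _)/le_trans; apply.
  by move=> i ci; rewrite /L cs// psi_at0 ln1 expr0n/= !mul0r subrr.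
by apply: ler_sum => g _; rewrite expR_sum; under [in leRHS]eq_bigr do rewrite FE.
Qed.

Let sU (x : Rd d) i : R := \sum_k U k i * vec x k 0.

Let sum_sU2 x : \sum_i sU x i ^+ 2 = \sum_k vec x k 0 ^+ 2.
Proof.
have E : (U^T *m vec x)^T *m (U^T *m vec x) = (vec x)^T *m vec x.
  by rewrite trmx_mul trmxK -mulmxA (mulmxA U) orthoU mul1mx.
have := congr1 (fun M : 'M[R]_1 => M 0 0) E; rewrite !mxE => E'.
transitivity (\sum_i (U^T *m vec x)^T 0 i * (U^T *m vec x) i 0).
  apply: eq_bigr => i _; rewrite !mxE -expr2; congr (_ ^+ 2); apply: eq_bigr => k _; by rewrite mxE.
by rewrite E'; apply: eq_bigr => k _; rewrite mxE expr2.
Qed.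

(** U^T is an isometry, so the Gaussian weight on R^d distributes over the n forms and equips each
    phi_i with its own Gaussian factor. *)
Let prod_gw x : \prod_k gw (vec x k 0) = expR (- (\sum_i sU x i ^+ 2 / 2)).
Proof.
rewrite -mulr_suml sum_sU2 mulr_suml -sumrN expR_sum.
by apply: eq_bigr => k _; rewrite gwE.
Qed.

Let csq0_sU x i : c i = 0 -> sU x i = 0.
Proof.
move=> /eqP; rewrite psumr_eq0 => [/allP ci|k _]; last exact: sqr_ge0.
apply: big1 => k _; have := ci k; rewrite mem_index_enum => /(_ isT).
by rewrite sqrf_eq0 => /eqP ->; rewrite mul0r.
Qed.

Let A (g : {ffun 'I_d -> 'I_n}) : 'M[R]_d := \matrix_(j, k) U k (g j).

Let prodF_prodlin (g : {ffun 'I_d -> 'I_n}) x :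
  (\prod_j F (g j) (sU x (g j)))%:E = prodlin (fun j => F (g j)) (A g) 0 x.
Proof.
rewrite /prodlin; congr EFin; apply: eq_bigr => j _; congr (F _ _).
by rewrite addr0 mxE; apply: eq_bigr => k _; rewrite mxE.
Qed.

Let Bp : R := 76 * (4 * expR 2 * p).

(** For d > 0 some coordinate exists, since the [csq] add up to d, and its ball masses are
    nonnegative. *)
Let p0 : (0 < d)%N -> 0 <= p.
Proof.
move=> d0; have [i _] : exists i : 'I_n, true.
  case: (posnP n) => [n0|n0]; last by exists (Ordinal n0).
  move: (sum_csq orthoU); rewrite big1 => [/esym/eqP|i _]; last by move: (ltn_ord i); rewrite {2}n0.
  by rewrite pnatr_eq0 -leqn0 leqNgt d0.
by apply: le_trans (qp i 0); apply: sumr_ge0.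
Qed.

Let int_F i : 0 < c i -> (\int[mu]_s (F i s)%:E <= (sq2pi * Bp * Num.sqrt (c i))%:E)%E.
Proof.
move=> ci; apply: le_trans (integral_psi_powR y (q0 i) (q1 i) ci (c4 i)) _.
rewrite lee_fin ler_wpM2r ?sqrtr_ge0// /Bp [leRHS]mulrCA ler_wpM2l//.
exact: Kpsi_le.
Qed.

(** Tuples with zero determinant carry no weight. For the others all columns are nonzero and the
    Jacobian 1 / |det| cancels one of the two powers of the determinant in [lg g]. *)
Let gint_le (g : {ffun 'I_d -> 'I_n}) : ((lg g)%:E * gint (fun j => F (g j)) (A g) 0 <=
  (`|detg U g| / d`!%:R * ((sq2pi * Bp) ^+ d * \prod_j Num.sqrt (c (g j))))%:E)%E.
Proof.
have [D0|D0] := eqVneq (detg U g) 0.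
  by rewrite /lg D0 normr0 expr0n/= !mul0r mul0e.
have cg j : 0 < c (g j).
  rewrite lt_neqAle csq_ge0 andbT eq_sym; apply: contra_neq D0; exact: detg_csq0.
rewrite gint_linear//; last by rewrite unitmxE unitfE.
rewrite muleA -EFinM -/(detg U g).
have -> : lg g * `|detg U g|^-1 = `|detg U g| / d`!%:R.
  rewrite /lg -[detg U g ^+ 2]real_normK ?num_real// mulrAC expr2.
  by rewrite mulfK// normr_eq0.
apply: (@le_trans _ _ ((`|detg U g| / d`!%:R)%:E * \prod_j (sq2pi * Bp * Num.sqrt (c (g j)))%:E)%E).
  apply: lee_wpmul2l; first by rewrite lee_fin divr_ge0.
  apply: prode_le => j; last exact: int_F.
  by apply: integral_ge0 => s _; rewrite lee_fin.
by rewrite prodEFin -EFinM lee_fin big_split prodr_const card_ord.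
Qed.

Let Q (f : {ffun 'I_n -> 'I_K}) : R := \prod_i q i (f i).

Let Q0 f : 0 <= Q f. Proof. exact: prodr_ge0. Qed.

Let Q1 : \sum_f Q f = 1.
Proof. by rewrite -(bigA_distr_bigA (fun i k => q i k)) /= big1. Qed.

Variable v : 'cV[R]_n.
Let cf f k : R := (U *m (\col_i y (f i) - v)) k 0.
Let S : R := \sum_f Q f * \prod_k gw (cf f k).

Let mQcos : measurable_fun setT (fun x : Rd d => (\sum_f (Q f)%:E * (cosgauss (cf f) 0 x)%:E)%E).
Proof.
apply: emeasurable_sum => f; apply/measurable_EFinP; apply: measurable_funM => //.
by apply/measurable_EFinP; exact: measurable_cosgauss.
Qed.

(** Fourier inversion for [S], shifted by the Gaussian mass that keeps the integrand nonnegative. *)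
Let int_Q : (\int[lam d]_x (\sum_f (Q f)%:E * (cosgauss (cf f) 0 x)%:E) = (sq2pi ^+ d * (1 + S))%:E)%E.
Proof.
rewrite ge0_integral_sum//; last 2 first.
- move=> f; apply/measurable_EFinP; apply: measurable_funM => //.
  by apply/measurable_EFinP; exact: measurable_cosgauss.
- by move=> f x _; rewrite -EFinM lee_fin; apply: mulr_ge0 => //; exact: cosgauss_ge0.
transitivity (\sum_f (Q f * (sq2pi ^+ d * (1 + \prod_k gw (cf f k))))%:E)%E.
  apply: eq_bigr => f _; rewrite ge0_integralZl//.
  - by rewrite integral_cosgauss cos0 mul1r -EFinM.
  - exact: measurable_cosgauss.
  - by move=> x _; rewrite lee_fin cosgauss_ge0.
  - by rewrite lee_fin.
rewrite sumEFin; congr EFin; rewrite /S.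
have -> : 1 + \sum_f Q f * \prod_k gw (cf f k) = \sum_f Q f + \sum_f Q f * \prod_k gw (cf f k).
  by rewrite Q1.
by rewrite -big_split mulr_sumr; apply: eq_bigr => f _ /=; ring.
Qed.

Let sum_cosgauss_le x : \sum_f Q f * cosgauss (cf f) 0 x <=
  \prod_k gw (vec x k 0) + \sum_g lg g * \prod_j F (g j) (sU x (g j)).
Proof.
rewrite /cosgauss.
have -> : \sum_f Q f * ((1 + cos (\sum_k cf f k * vec x k 0 + 0)) * \prod_k gw (vec x k 0)) =
   \prod_k gw (vec x k 0) + (\sum_f Q f * cos (\sum_k cf f k * vec x k 0 + 0)) * \prod_k gw (vec x k 0).
  set G := \prod_k gw (vec x k 0).
  transitivity ((\sum_f Q f) * G + (\sum_f Q f * cos (\sum_k cf f k * vec x k 0 + 0)) * G).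
    by rewrite -mulrDl -big_split mulr_suml; apply: eq_bigr => f _ /=; ring.
  by rewrite Q1 mul1r.
rewrite lerD2l; apply: le_trans (prod_sqrt_psi_le (csq0_sU x)).
rewrite prod_gw ler_wpM2r ?expR_ge0//.
(* The centre [v] enters only through the phase, which is why the final bound is uniform in [v]. *)
have := sum_cos_le q y (sU x) (- \sum_i sU x i * v i 0).
congr (_ <= _); apply: eq_bigr => f _; congr (_ * cos _).
rewrite addr0 /cf /sU -sumrB.
under [RHS]eq_bigr do rewrite mxE mulr_suml.
rewrite exchange_big /=; apply: eq_bigr => i _.
rewrite -mulrBr mulr_suml; apply: eq_bigr => k _; rewrite !mxE; ring.
Qed.

Lemma small_projection_bound : S <= (76 * (4 * expR 2 * p) * expR 1) ^+ d.
Proof.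
have H : ((sq2pi ^+ d * (1 + S))%:E <= (sq2pi ^+ d)%:E +
   \sum_g (`|detg U g| / d`!%:R * ((sq2pi * Bp) ^+ d * \prod_j Num.sqrt (c (g j))))%:E)%E.
  rewrite -int_Q -integral_prod_gauss.
  have mp (g : {ffun 'I_d -> 'I_n}) : measurable_fun setT (fun x => (lg g)%:E * prodlin (fun j => F (g j)) (A g) 0 x)%E.
    by apply: measurable_funeM; apply: measurable_prodlin.
  have pp (g : {ffun 'I_d -> 'I_n}) x : (0 <= (lg g)%:E * prodlin (fun j => F (g j)) (A g) 0 x)%E.
    by apply: mule_ge0; [rewrite lee_fin|exact: prodlin_ge0].
  have mG : measurable_fun setT (fun x : Rd d => (\prod_k gw (vec x k 0))%:E).
    by apply/measurable_EFinP; exact: measurable_prod_gauss.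
  apply: (@le_trans _ _ (\int[lam d]_x ((\prod_k gw (vec x k 0))%:E +
     \sum_g (lg g)%:E * prodlin (fun j => F (g j)) (A g) 0 x))%E).
    apply: ge0_le_integral => //.
    - move=> x _; apply: sume_ge0 => f _; rewrite -EFinM lee_fin; apply: mulr_ge0 => //; exact: cosgauss_ge0.
    - by apply: emeasurable_funD => //; apply: emeasurable_sum.
    - move=> x _; apply: (@le_trans _ _ (\sum_f Q f * cosgauss (cf f) 0 x)%:E).
        by rewrite -sumEFin.
      apply: (@le_trans _ _ (\prod_k gw (vec x k 0) + \sum_g lg g * \prod_j F (g j) (sU x (g j)))%:E).
        by rewrite lee_fin.
      rewrite EFinD leeD2l// -sumEFin le_eqVlt; apply/orP; left; apply/eqP.
      by apply: eq_bigr => g _; rewrite EFinM prodF_prodlin.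
  rewrite ge0_integralD//; last 3 first.
  - by move=> x _; rewrite lee_fin prod_gauss_ge0.
  - by move=> x _; apply: sume_ge0.
  - by apply: emeasurable_sum.
  rewrite leeD2l// ge0_integral_sum//; apply: lee_sum => g _.
  have := gint_le g; rewrite /gint -ge0_integralZl//.
  - by apply: measurable_prodlin.
  - by move=> x _; apply: prodlin_ge0.
  - by rewrite lee_fin.
(* The Gaussian mass added for nonnegativity is the same on both sides and cancels here. *)
move: H; rewrite sumEFin -EFinD lee_fin mulrDr mulr1 lerD2l.
have s0 : 0 < sq2pi by rewrite sqrtr_gt0 pmulrn_lgt0// pi_gt0.
have -> : \sum_g `|detg U g| / d`!%:R * ((sq2pi * Bp) ^+ d * \prod_j Num.sqrt (c (g j))) =
   sq2pi ^+ d * (Bp ^+ d / d`!%:R * \sum_g `|detg U g| * \prod_j Num.sqrt (c (g j))).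
  by rewrite !mulr_sumr; apply: eq_bigr => g _; rewrite exprMn; ring.
rewrite ler_pM2l ?exprn_gt0// => /le_trans; apply.
have Bd0 : 0 <= Bp ^+ d.
  case: (posnP d) => [->|d0]; first by rewrite expr0.
  by apply: exprn_ge0; rewrite /Bp !mulr_ge0 ?expR_ge0// p0.
have -> : (76 * (4 * expR 2 * p) * expR 1) ^+ d = Bp ^+ d * expR 1 ^+ d by rewrite -exprMn.
rewrite -mulrA ler_wpM2l// ler_pdivrMl ?fact_gt0R//.
(* Cauchy-Schwarz in the form a b <= (a^2 + b^2) / 2: the two sums are d! and d^d, each at most d!
   e^d. *)
apply: (@le_trans _ _ (\sum_g 2^-1 * (detg U g ^+ 2 + \prod_j c (g j)))).
  apply: ler_sum => g _; rewrite -[detg U g ^+ 2]real_normK ?num_real//.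
  have -> : \prod_j c (g j) = (\prod_j Num.sqrt (c (g j))) ^+ 2.
    by rewrite -prodrXl; apply: eq_bigr => j _; rewrite sqr_sqrtr// csq_ge0.
  set a := `|_|; set b := \prod_j _; have := sqr_ge0 (a - b); lra.
rewrite -mulr_sumr big_split /= sum_detg2_1// sum_prod_csq//.
have := @pow_fact_le R d; rewrite -expRM_natl mulr1 => h1.
have h2 : d`!%:R <= d`!%:R * expR d%:R :> R.
  by rewrite ler_peMr// (le_trans _ (expR_ge1Dx _))// lerDl.
lra.
Qed.

End small.

(** * Induction on the rank *)

Section symidem.
Context {R : realType} (n : nat).
Implicit Types (P : 'M[R]_n) (x : 'cV[R]_n).

Definition symidem P := P^T = P /\ P *m P = P.
Definition qform P x : R := (x^T *m P *m x) 0 0.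

(* For symmetric idempotent [P], the projection onto the part of its range orthogonal to [P e_k] *)
Definition peel P k : 'M[R]_n := P - (P k k)^-1 *: (col k P *m (col k P)^T).

Section peel.
Variables (P : 'M[R]_n) (k : 'I_n).
Hypothesis sP : symidem P.

Lemma symidem_diag i : P i i = \sum_j P i j ^+ 2.
Proof.
have [sP1 sP2] := sP; rewrite -{1}sP2 mxE; apply: eq_bigr => j _.
by rewrite -{2}sP1 mxE expr2.
Qed.

Lemma symidem_diag_ge0 i : 0 <= P i i.
Proof. by rewrite symidem_diag; apply: sumr_ge0 => j _; rewrite sqr_ge0. Qed.

Lemma symidem_diag0 i j : P i i = 0 -> P i j = 0.
Proof.
rewrite symidem_diag => /eqP; rewrite psumr_eq0 => [/allP/(_ j)|l _]; last exact: sqr_ge0.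
by rewrite mem_index_enum sqrf_eq0 => /(_ isT)/eqP.
Qed.

Hypothesis Pk : P k k != 0.
Let w := col k P.

Let Pw : P *m w = w. Proof. by rewrite /w !colE mulmxA sP.2. Qed.

Let wP : w^T *m P = w^T.
Proof. by rewrite -[X in _ *m X]sP.1 -trmx_mul Pw. Qed.

Lemma col_sqr_norm : w^T *m w = (P k k)%:M.
Proof.
rewrite [LHS]mx11_scalar; congr (_%:M); rewrite mxE symidem_diag; apply: eq_bigr => j _.
by rewrite !mxE -expr2 -[in LHS]sP.1 mxE.
Qed.

Lemma peel_mul_col : peel P k *m w = 0.
Proof.
rewrite mulmxBl Pw -scalemxAl -mulmxA col_sqr_norm mul_mx_scalar scalerA mulVf// scale1r.
by rewrite subrr.
Qed.

Lemma symidem_peel : symidem (peel P k).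
Proof.
have t : (peel P k)^T = peel P k.
  by rewrite /peel linearB/= linearZ/= trmx_mul trmxK sP.1.
split=> //; rewrite {2}/peel mulmxBr -scalemxAr mulmxA peel_mul_col mul0mx scaler0 subr0.
by rewrite mulmxBl sP.2 -scalemxAl -mulmxA wP.
Qed.

Lemma peel_row0 i : peel P k i k = 0.
Proof.
by rewrite !mxE big_ord1 !mxE mulrCA mulVf// mulr1 subrr.
Qed.

Lemma peel_diag0 i : P i i = 0 -> peel P k i i = 0.
Proof.
move=> Pi; rewrite !mxE big_ord1 !mxE Pi (symidem_diag0 _ Pi).
by rewrite mul0r mulr0 subr0.
Qed.

Lemma tr_peel : \tr (peel P k) = \tr P - 1.
Proof.
rewrite /peel linearB/= linearZ/= mxtrace_mulC -/w col_sqr_norm mxtrace_scalar mulVf//.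
Qed.

(** Pythagoras in the range of [P], along the direction P e_k, whose squared length is P_kk. *)
Lemma qform_peel x : qform P x = qform (peel P k) x + (P k k)^-1 * ((w^T *m x) 0 0) ^+ 2.
Proof.
rewrite /qform /peel -/w mulmxBr mulmxBl -scalemxAr -scalemxAl.
rewrite [(x^T *m P *m x - _) 0 0]mxE [(- _ : 'M[R]_1) 0 0]mxE [(_ *: _ : 'M[R]_1) 0 0]mxE.
suff -> : (x^T *m (w *m w^T) *m x) 0 0 = ((w^T *m x) 0 0) ^+ 2 by rewrite subrK.
have -> : x^T *m (w *m w^T) *m x = (w^T *m x)^T *m (w^T *m x).
  by rewrite trmx_mul trmxK !mulmxA.
by rewrite mxE big_ord1 mxE expr2.
Qed.

End peel.

(** The rows of [U] form an orthonormal basis of the range. Induction on the number of nonzero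
    diagonal entries: peeling kills the k-th without creating new ones, and the normalised column P
    e_k is orthogonal to the rows found for [peel P k]. *)
Lemma symidem_factor P : symidem P ->
  exists d (U : 'M[R]_(d, n)), U *m U^T = 1%:M /\ P = U^T *m U.
Proof.
move: {2}#|_| (leqnn #|[set i | P i i != 0]%SET|) => N.
elim: N P => [|N IH] P cN sP.
  have P0 i : P i i = 0.
    apply/eqP/negPn/negP => Pi; move: cN; rewrite leqn0 cards_eq0 => /eqP/setP/(_ i).
    by rewrite !inE Pi.
  exists 0%N, 0; split; first by apply/matrixP => -[].
  by rewrite mulmx0; apply/matrixP => i j; rewrite mxE (symidem_diag0 sP _ (P0 i)).
have [/existsP[k Pk]|/existsPn P0] := boolP [exists k, P k k != 0]; last first.
  apply: IH sP; rewrite (_ : [set i | P i i != 0]%SET = finset.set0) ?cards0//.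
  by apply/setP => i; rewrite !inE (negbTE (P0 i)).
have [||d [U [UU PE]]] := IH (peel P k); last first.
- have Uw : U *m col k P = 0.
    have := peel_mul_col sP Pk; rewrite PE => /(congr1 (mulmx U)).
    by rewrite !mulmxA UU mul1mx mulmx0.
  have a0 : 0 < P k k by rewrite lt_neqAle eq_sym Pk symidem_diag_ge0.
  exists (1 + d)%N, (col_mx (Num.sqrt (P k k)^-1 *: (col k P)^T) U); split.
  + set r := Num.sqrt _; set w := col k P.
    have rT : (r *: w^T)^T = r *: w by rewrite linearZ /= trmxK.
    rewrite tr_col_mx mul_col_row UU rT -!scalemxAl -!scalemxAr Uw scaler0.
    have wU : w^T *m U^T = 0 by rewrite -trmx_mul Uw trmx0.
    rewrite wU scaler0 col_sqr_norm// scalerA -expr2 sqr_sqrtr ?invr_ge0 ?ltW//.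
    by rewrite scale_scalar_mx mulVf// -scalar_mx_block.
  + have rT : (Num.sqrt (P k k)^-1 *: (col k P)^T)^T = Num.sqrt (P k k)^-1 *: col k P.
      by rewrite linearZ /= trmxK.
    rewrite tr_col_mx mul_row_col -PE rT -scalemxAl -scalemxAr scalerA.
    by rewrite -expr2 sqr_sqrtr ?invr_ge0 ?ltW// /peel addrC subrK.
- exact: symidem_peel.
- rewrite -ltnS; apply: leq_trans cN; apply: proper_card; apply/properP; split.
    apply/fintype.subsetP => i; rewrite !inE; apply: contra_neq; exact: peel_diag0.
  by exists k; rewrite !inE ?Pk// negbK peel_row0.
Qed.

Lemma symidem_tr_factor d (U : 'M[R]_(d, n)) : U *m U^T = 1%:M -> \tr (U^T *m U) = d%:R.
Proof. by move=> UU; rewrite mxtrace_mulC UU mxtrace1. Qed.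

End symidem.

(** * Discrete laws: peeling off large diagonal entries *)

Section core.
Context {R : realType} (n K : nat) (q : 'I_n -> 'I_K -> R) (y : 'I_K -> R) (p : R).
Hypothesis q0 : forall i k, 0 <= q i k.
Hypothesis q1 : forall i, \sum_k q i k = 1.
Hypothesis qp : forall i x, \sum_(k | `|y k - x| <= 1) q i k <= p.
Variable v : 'cV[R]_n.

Let Q (f : {ffun 'I_n -> 'I_K}) : R := \prod_i q i (f i).
Let X (f : {ffun 'I_n -> 'I_K}) : 'cV[R]_n := \col_i y (f i) - v.
Let upd (f : {ffun 'I_n -> 'I_K}) k b : {ffun 'I_n -> 'I_K} :=
  [ffun i => if i == k then b else f i].

(* Resampling coordinate [k]: the involution (f, b) |-> (f[k := b], f k) preserves the weight *)
Lemma sum_resample (h : {ffun 'I_n -> 'I_K} -> R) k :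
  \sum_f Q f * h f = \sum_f Q f * \sum_b q k b * h (upd f k b).
Proof.
transitivity (\sum_(u : {ffun 'I_n -> 'I_K} * 'I_K) Q u.1 * q k u.2 * h u.1).
  rewrite -(pair_bigA _ (fun f b => Q f * q k b * h f)) /=; apply: eq_bigr => f _.
  by rewrite -mulr_suml -mulr_sumr q1 mulr1.
pose sw (u : {ffun 'I_n -> 'I_K} * 'I_K) := (upd u.1 k u.2, u.1 k).
have swK : involutive sw.
  move=> [f b]; rewrite /sw /=; congr (_, _); last by rewrite ffunE eqxx.
  by apply/ffunP => i; rewrite !ffunE; case: eqP => [->|].
rewrite (reindex_inj (inv_inj swK)) /=.
transitivity (\sum_(u : {ffun 'I_n -> 'I_K} * 'I_K) Q u.1 * q k u.2 * h (upd u.1 k u.2)).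
  apply: eq_bigr => -[f b] _ /=; congr (_ * _).
  rewrite /Q (bigD1 k)//= [in RHS](bigD1 k)//= ffunE eqxx.
  rewrite (eq_bigr (fun i => q i (f i))) => [|i ik]; last by rewrite ffunE (negbTE ik).
  by ring.
rewrite -(pair_bigA _ (fun f b => Q f * q k b * h (upd f k b))) /=; apply: eq_bigr => f _.
by rewrite mulr_sumr; apply: eq_bigr => b _; rewrite mulrA.
Qed.

Let M P := \sum_f Q f * expR (- (qform P (X f) / 2)).

(** Only the term P_kk (y_b - t)^2 of the quadratic form depends on coordinate k, because [peel P k]
    annihilates e_k. As P_kk > 1/4, its exponential is at most [gauss 2 (y b - t)], and
    [sum_gauss2_le] applies. *)
Lemma sum_peel P k : symidem P -> 4^-1 < P k k -> M P <= 4 * expR 2 * p * M (peel P k).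
Proof.
move=> sP Pk4; have Pk : P k k != 0 by lra.
rewrite /M (sum_resample _ k) mulr_sumr; apply: ler_sum => f _.
rewrite mulrCA ler_wpM2l ?prodr_ge0//.
(* The value of the k-th coordinate, given the others, at which X becomes orthogonal to P e_k. *)
pose t := v k 0 - (P k k)^-1 * \sum_(i | i != k) P i k * X f i 0.
have E b : qform P (X (upd f k b)) = qform (peel P k) (X f) + P k k * (y b - t) ^+ 2.
  rewrite (qform_peel P k); congr (_ + _).
    rewrite /qform; have [tP _] := symidem_peel sP Pk.
    have -> : X (upd f k b) = X f + (y b - y (f k)) *: delta_mx k 0.
      apply/matrixP => i j; rewrite !mxE ffunE (ord1 j) eqxx andbT.
      by case: eqP => [->|_]; rewrite ?mulr1 ?mulr0 ?addr0//; ring.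
    have P0 : peel P k *m delta_mx k 0 = 0 :> 'cV_n.
      by rewrite -colE; apply/matrixP => i j; rewrite mxE peel_row0// mxE.
    set z := X f + _.
    have Pz : peel P k *m z = peel P k *m X f.
      by rewrite mulmxDr -scalemxAr P0 scaler0 addr0.
    have sw (x : 'cV[R]_n) : x^T *m peel P k = (peel P k *m x)^T by rewrite trmx_mul tP.
    by rewrite -mulmxA Pz mulmxA !sw Pz.
  have -> : ((col k P)^T *m X (upd f k b)) 0 0 = P k k * (y b - t).
    rewrite mxE (bigD1 k)//= !mxE ffunE eqxx /t.
    rewrite (eq_bigr (fun i => P i k * X f i 0)) => [|i ik]; last first.
      by rewrite !mxE ffunE (negbTE ik).
    by field.
  by field.
under eq_bigr do rewrite E.
apply: (@le_trans _ _ (\sum_b expR (- (qform (peel P k) (X f) / 2)) * (q k b * gauss 2 (y b - t)))).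
  apply: ler_sum => b _; rewrite [leRHS]mulrCA ler_wpM2l// /gauss -expRD ler_expR.
  have := sqr_ge0 (y b - t); set z := (y b - t) ^+ 2 => z0; nra.
rewrite -mulr_sumr mulrC ler_wpM2r ?expR_ge0//.
exact: (sum_gauss2_le (q0 k) (qp k)).
Qed.

(** 76 * 4 * [expR 2] comes from the one-dimensional integrals and [expR 1] from d^d <= d! e^d. A
    peeling step costs only 4 * [expR 2], which is smaller. *)
Definition core_const : R := 76 * 4 * expR 2 * expR 1.

Lemma core_const_gt0 : 0 < core_const.
Proof. by rewrite !mulr_gt0 ?expR_gt0. Qed.

Lemma sum_gauss_projection d P : symidem P -> \tr P = d%:R ->
  M P <= (core_const * p) ^+ d.
Proof.
elim: d P => [|d IH] P sP tP.
  rewrite expr0 /M; apply: (@le_trans _ _ (\sum_f Q f)).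
    apply: ler_sum => f _; rewrite ler_piMr ?prodr_ge0// -expR0 ler_expR oppr_le0.
    rewrite divr_ge0// /qform -sP.2 -{1}sP.1 mulmxA -mulmxA -trmx_mul mxE.
    by apply: sumr_ge0 => i _; rewrite mxE -expr2 sqr_ge0.
  by rewrite -(bigA_distr_bigA (fun i k => q i k)) /= big1.
have [/existsP[k Pk]|/existsPn Ps] := boolP [exists k, 4^-1 < P k k].
  have Pk0 : P k k != 0 by lra.
  have p0 : 0 <= p by apply: le_trans (qp k 0); apply: sumr_ge0.
  apply: le_trans (sum_peel sP Pk) _; rewrite exprS.
  have tP' : \tr (peel P k) = d%:R by rewrite tr_peel// tP -natr1 addrK.
  apply: ler_pM => //; last exact: IH (symidem_peel sP Pk0) tP'.
  - by rewrite !mulr_ge0 ?expR_ge0.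
  - by apply: sumr_ge0 => f _; apply: mulr_ge0; [exact: prodr_ge0|exact: expR_ge0].
  - rewrite ler_wpM2r// /core_const -!mulrA -[leLHS]mul1r ler_pM ?mulr_ge0 ?expR_ge0//; first lra.
    by rewrite ler_wpM2l// ler_peMr ?expR_ge0// (le_trans _ (expR_ge1Dx 1))// lerDl.
have [d' [U [UU PE]]] := symidem_factor sP.
have dd : d' = d.+1.
  by apply/eqP; rewrite -(eqr_nat R) -(symidem_tr_factor UU) -PE tP.
move: U UU PE; rewrite dd => U UU PE.
have cU i : csq U i <= 4^-1.
  rewrite leNgt; apply: contra (Ps i); rewrite PE mxE => /lt_le_trans; apply.
  by rewrite le_eqVlt; apply/orP; left; apply/eqP; apply: eq_bigr => k _; rewrite mxE expr2.
have := small_projection_bound UU q0 q1 qp cU v.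
rewrite (_ : 76 * (4 * expR 2 * p) * expR 1 = core_const * p); last by rewrite /core_const; ring.
apply: le_trans; rewrite /M le_eqVlt; apply/orP; left; apply/eqP.
apply: eq_bigr => f _; congr (_ * _).
under [RHS]eq_bigr do rewrite gwE.
rewrite -expR_sum; congr expR; rewrite sumrN -mulr_suml; congr (- (_ / 2)).
rewrite /qform PE mulmxA -trmx_mul -mulmxA mxE; apply: eq_bigr => k _.
by rewrite mxE expr2.
Qed.

End core.

(** * Orthogonal projections as symmetric idempotent matrices *)

Section projection.
Context {R : realType} (n : nat).
Implicit Types (x y z : 'cV[R]_n) (P : 'M[R]_n) (E : {vspace 'cV[R]_n}).

Lemma dotvE x y : dotv x y = (x^T *m y) 0 0.
Proof. by rewrite mxE; apply: eq_bigr => i _; rewrite mxE. Qed.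

Lemma dotvv_ge0 x : 0 <= dotv x x.
Proof. by apply: sumr_ge0 => i _; rewrite -expr2 sqr_ge0. Qed.

Lemma dotvv_eq0 x : dotv x x = 0 -> x = 0.
Proof.
move=> /eqP; rewrite psumr_eq0 => [/allP h|i _]; last by rewrite -expr2 sqr_ge0.
apply/matrixP => i j; rewrite (ord1 j) mxE; have := h i; rewrite mem_index_enum => /(_ isT).
by rewrite -expr2 sqrf_eq0 => /eqP.
Qed.

Lemma dotv_mulmx P x y : dotv (P *m x) y = dotv x (P^T *m y).
Proof. by rewrite !dotvE trmx_mul mulmxA. Qed.

Lemma qform_dotv P x : symidem P -> qform P x = dotv (P *m x) (P *m x).
Proof. by move=> [P1 P2]; rewrite dotv_mulmx P1 mulmxA P2 dotvE mulmxA. Qed.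

Lemma qformD_le P x y : symidem P -> qform P (x + y) <= 2 * qform P x + 2 * qform P y.
Proof.
move=> sP; rewrite !qform_dotv// mulmxDr /dotv !mulr_sumr -big_split /=.
apply: ler_sum => i _; rewrite !mxE; set a := \sum_j _; set b := \sum_j _.
have := sqr_ge0 (a - b); lra.
Qed.

Lemma qform_le P x : symidem P -> qform P x <= dotv x x.
Proof.
move=> sP; rewrite qform_dotv//.
have e : dotv x (P *m x) = dotv (P *m x) (P *m x).
  by rewrite dotv_mulmx sP.1 mulmxA sP.2.
have := dotvv_ge0 (x - P *m x).
have -> : dotv (x - P *m x) (x - P *m x) = dotv x x - 2 * dotv x (P *m x) + dotv (P *m x) (P *m x).
  rewrite /dotv mulr_sumr -sumrB -big_split; apply: eq_bigr => i _; rewrite !mxE /=; ring.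
rewrite e; lra.
Qed.

Lemma mulmx_ext (A B : 'M[R]_n) : (forall x, A *m x = B *m x) -> A = B.
Proof.
move=> AB; apply/matrixP => i j.
by have := AB (delta_mx j 0); rewrite -!colE => /(congr1 (fun M : 'cV[R]_n => M i 0)); rewrite !mxE.
Qed.

Section orth.
Variables (P : 'M[R]_n) (E : {vspace 'cV[R]_n}).
Hypothesis PE : is_orthogonal_projection P E.

(** y - P y lies in [E] and is orthogonal to [E], hence to itself. *)
Lemma orthogonal_projection_id y : y \in E -> P *m y = y.
Proof.
move=> yE; have [Py H] := PE y; apply/esym/eqP; rewrite -subr_eq0; apply/eqP/dotvv_eq0.
by apply: H; exact: rpredB.
Qed.

Lemma orthogonal_projection_symidem : symidem P.
Proof.
have PP : P *m P = P.
  apply: mulmx_ext => x; rewrite -mulmxA orthogonal_projection_id//.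
  by have [] := PE x.
have S x y : dotv (P *m x) y = dotv x (P *m y).
  have dB a b c : dotv (a - b) c = dotv a c - dotv b c.
    by rewrite /dotv -sumrB; apply: eq_bigr => i _; rewrite !mxE mulrBl.
  have dC a b : dotv a b = dotv b a by apply: eq_bigr => i _; rewrite mulrC.
  have := (PE x).2 _ (PE y).1; have := (PE y).2 _ (PE x).1.
  rewrite !dB [dotv y _]dC [dotv (P *m y) (P *m x)]dC => /eqP; rewrite subr_eq0 => /eqP -> /eqP.
  by rewrite subr_eq0 => /eqP ->.
split=> //; apply/matrixP => i j; rewrite mxE.
have dd (A : 'M[R]_n) a b : dotv (delta_mx a 0) (A *m delta_mx b 0) = A a b.
  rewrite /dotv (bigD1 a)//= big1 ?addr0 => [|k ka].
    by rewrite -colE !mxE !eqxx mul1r.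
  by rewrite !mxE (negbTE ka) mul0r.
by rewrite -dd -S dotv_mulmx dd mxE.
Qed.

(** In P = U^T U with orthonormal rows, U^T maps R^d injectively onto [E], and the trace of P is
    d. *)
Lemma orthogonal_projection_tr : \tr P = (\dim E)%:R.
Proof.
have [d [U [UU PU]]] := symidem_factor orthogonal_projection_symidem.
rewrite PU symidem_tr_factor//; congr (_%:R).
pose f : 'Hom('cV[R]_d, 'cV[R]_n) := linfun (mulmx U^T).
have fE (z : 'cV[R]_d) : f z = U^T *m z by rewrite lfunE.
have -> : E = (f @: fullv)%VS.
  apply/vspaceP => x; apply/idP/memv_imgP => [xE|[z _ ->]].
    by exists (U *m x); rewrite ?memvf// fE mulmxA -PU orthogonal_projection_id.
  rewrite fE; have [+ _] := PE (U^T *m z).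
  by rewrite PU -mulmxA [U *m (_ *m _)]mulmxA UU mul1mx.
rewrite limg_dim_eq; last first.
  apply/eqP; rewrite capfv; apply/lker0P => a b; rewrite !fE => /(congr1 (mulmx U)).
  by rewrite !mulmxA UU !mul1mx.
by rewrite dimvf; exact: (esym (muln1 d)).
Qed.

End orth.
End projection.

(** * Passage to general random variables *)

Section finite_events.
Context d (T : measurableType d) (R : realType) (Pr : probability T R).

Lemma mem_bigsetU (I : finType) (P : pred I) (F : I -> set T) w :
  (\big[setU/set0]_(i | P i) F i) w <-> exists i, P i /\ F i w.
Proof.
split=> [|[i [Pi Fi]]]; last by rewrite (bigD1 i)//=; left.
apply: (big_ind (fun A : set T => A w -> exists i, P i /\ F i w)) => //.
- by move=> A B hA hB [/hA|/hB].
- by move=> i Pi Fi; exists i.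
Qed.

Lemma probability_le_sum (I : finType) (P : pred I) (A : set T) (F : I -> set T) :
  measurable A -> (forall i, measurable (F i)) ->
  (forall w, A w -> exists i, P i /\ F i w) -> (Pr A <= \sum_(i | P i) Pr (F i))%E.
Proof.
move=> mA mF AF; have mU : measurable (\big[setU/set0]_(i | P i) F i).
  by apply: bigsetU_measurable.
apply: (@le_trans _ _ (Pr (\big[setU/set0]_(i | P i) F i))).
  apply: le_measure; rewrite ?inE// => w /AF; by move/mem_bigsetU.
suff: measurable (\big[setU/set0]_(i | P i) F i) /\
   (Pr (\big[setU/set0]_(i | P i) F i) <= \sum_(i | P i) Pr (F i))%E by case.
apply: (big_ind2 (fun (A : set T) x => measurable A /\ (Pr A <= x)%E)).
- by split=> //; rewrite measure0.
- move=> A1 x1 A2 x2 [m1 h1] [m2 h2]; split; first exact: measurableU.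
  by apply: le_trans (measureU2 _ m1 m2) _; exact: leeD.
- by move=> i Pi.
Qed.

Lemma sum_probability_fiber K (k : T -> 'I_K) (S : pred 'I_K) :
  (forall b, measurable [set w | k w = b]) ->
  (\sum_(b | S b) Pr [set w | k w = b] = Pr [set w | S (k w)])%E.
Proof.
move=> mk; rewrite -measure_bigsetU_ord_cond//.
- congr (Pr _); apply/seteqP; split=> w.
    by move=> /mem_bigsetU[b [Sb /= kb]]; rewrite kb.
  by move=> /= Sw; apply/mem_bigsetU; exists (k w).
- by move=> a b _ _ [w [/= <- <-]].
Qed.

End finite_events.

Section random_variable_bounds.
Context d (T : measurableType d) (R : realType) (Pr : probability T R).
Variable X : {RV Pr >-> R}.

Lemma measurable_RV_preimage (A : set R) : measurable A -> measurable (X @^-1` A).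
Proof. by move=> mA; exact: measurable_funPTI. Qed.

Lemma measurable_RV_ball x t : measurable [set w | `|X w - x| <= t].
Proof.
rewrite (_ : [set w | _] = X @^-1` `[x - t, x + t]%classic); first exact: measurable_RV_preimage.
by apply/seteqP; split=> w /=; rewrite in_itv/= ler_distl.
Qed.

Lemma measurable_RV_tail t : measurable [set w | t <= `|X w|].
Proof.
rewrite (_ : [set w | _] = ~` (X @^-1` `](- t), t[%classic)).
  by apply: measurableC; exact: measurable_RV_preimage.
apply/seteqP; split=> w /=; rewrite in_itv/= -ltr_norml; first by rewrite leNgt => /negP.
by move=> /negP; rewrite -leNgt.
Qed.

Lemma probability_tight e : 0 < e -> exists m : nat, (Pr [set w | (m%:R <= `|X w|)%R] <= e%:E)%E.
Proof.
move=> e0; pose F (m : nat) := [set w | m%:R <= `|X w|].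
have mF m : measurable (F m) by exact: measurable_RV_tail.
have F0 : \bigcap_m F m = set0.
  rewrite -subset0 => w Fw; have := Fw (Num.trunc `|X w|).+1 I.
  have /andP[_] := Num.Theory.trunc_itv (normr_ge0 (X w)).
  by rewrite /F /= leNgt => ->.
have := @nonincreasing_cvg_mu _ _ _ Pr F.
rewrite F0 measure0 => /(_ _ mF measurable0 _).
move=> /(_ _ _)/wrap[].
- by rewrite (le_lt_trans (probability_le1 _ (mF _))) ?ltry.
- apply/nonincreasing_seqP => m; apply/subsetPset => w; rewrite /F /=.
  by apply: le_trans; rewrite ler_nat.
move=> /fine_cvgP[_] /cvgr0_norm_lt/(_ _ e0)[m _ /(_ m (leqnn m))] /= h.
exists m; rewrite -/(F m) -[Pr (F m)]fineK ?fin_num_measure// lee_fin.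
by apply: ltW; apply: le_lt_trans h; exact: ler_norm.
Qed.

Lemma probability_small_ball p x : (Pr [set w | (`|X w - x| <= 0)%R] < p%:E)%E ->
  exists2 r, 0 < r & (Pr [set w | (`|X w - x| <= r)%R] < p%:E)%E.
Proof.
move=> hp; pose F (m : nat) := [set w | `|X w - x| <= harmonic m].
have mF m : measurable (F m) by exact: measurable_RV_ball.
have F0 : \bigcap_m F m = [set w | `|X w - x| <= 0].
  apply/seteqP; split=> w Fw /=; last first.
    by move=> m _; apply: le_trans Fw _; exact: harmonic_ge0.
  apply/ler_addgt0Pr => e e0; rewrite add0r.
  have /cvgrPdist_lt/(_ _ e0)[m _ /(_ m (leqnn m))] := @cvg_harmonic R.
  rewrite sub0r normrN ger0_norm ?harmonic_ge0// => hm.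
  exact: le_trans (Fw m I) (ltW hm).
have := @nonincreasing_cvg_mu _ _ _ Pr F.
rewrite F0 => /(_ _ mF (measurable_RV_ball _ _) _).
move=> /(_ _ _)/wrap[].
- by rewrite (le_lt_trans (probability_le1 _ (mF _))) ?ltry.
- apply/nonincreasing_seqP => m; apply/subsetPset => w; rewrite /F /= => /le_trans; apply.
  by rewrite lef_pV2 ?posrE// ler_nat.
have E : Pr [set w | (`|X w - x| <= 0)%R] = (fine (Pr [set w | (`|X w - x| <= 0)%R]))%:E.
  by rewrite fineK// fin_num_measure//; exact: measurable_RV_ball.
move: hp E; set L := Pr [set w | (`|X w - x| <= 0)%R] => hp E hc.
have {hc} : Pr \o F @ \oo --> (fine L)%:E by rewrite -E.
move=> /fine_cvgP[_].
move: hp; rewrite E lte_fin; set l := fine _ => lp.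
rewrite -subr_gt0 in lp.
move=> /cvgrPdist_lt/(_ _ lp)[m _ /(_ m (leqnn m))] /= h.
exists (harmonic m); first exact: harmonic_gt0.
rewrite -/(F m) -[Pr (F m)]fineK ?fin_num_measure// lte_fin.
by move: h; rewrite ltr_norml => /andP[+ _]; lra.
Qed.

(** For t = 0 the hypothesis only bounds atoms. Each point has a good radius by continuity from
    above, compactness makes the radius uniform on a bounded interval, and tightness handles the
    centres outside it. *)
Lemma probability_uniform_small_ball p : 0 <= p ->
  (forall x, Pr [set w | (`|X w - x| <= 0)%R] <= p%:E)%E ->
  forall e, 0 < e -> exists2 t, 0 < t & forall x, (Pr [set w | (`|X w - x| <= t)%R] <= (p + e)%:E)%E.
Proof.
move=> p0 hp e e0; have [m hm] := probability_tight e0.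
pose b : R := m%:R + 1.
have cK : compact (`[- b, b]%classic : set R) by exact: segment_compact.
have H x : `[- b, b]%classic x -> \forall x' \near x & t \near (0:R)^'+,
    (Pr [set w | (`|X w - x'| <= t)%R] <= (p + e)%:E)%E.
  move=> _; have hx : (Pr [set w | (`|X w - x| <= 0)%R] < (p + e)%:E)%E.
    by apply: le_lt_trans (hp x) _; rewrite lte_fin ltrDl.
  have [r r0 hr] := probability_small_ball hx.
  have r20 : 0 < r / 2 by rewrite divr_gt0.
  exists ([set z | `|x - z| < r / 2], [set t | t < r / 2]) => /=.
    split; first by exists (r / 2).
    exact: nbhs_right_lt.
  move=> [z t] /= [xz tr]; apply: le_trans (ltW hr); apply: le_measure;
    rewrite ?inE; [exact: measurable_RV_ball..|].
  move=> w /= hw; rewrite -(subrK z (X w)) -addrA; apply: le_trans (ler_normD _ _) _.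
  by rewrite distrC in xz; lra.
have := (compact_near_coveringP _).1 cK R ((0:R)^'+)
  (fun t x => (Pr [set w | (`|X w - x| <= t)%R] <= (p + e)%:E)%E) _ H.
move=> hF; have : \forall t \near (0:R)^'+, 0 < t /\ t < 1 /\
    (* With b = m + 1, requiring t < 1 places every ball centred outside [-b, b] in the tail |X| >=
       m. *)
    `[- b, b]%classic `<=` (fun x => (Pr [set w | (`|X w - x| <= t)%R] <= (p + e)%:E)%E).
  near=> t; split; [|split]; near: t; [exact: nbhs_right_gt|exact: nbhs_right_lt|exact: hF].
move=> /filter_ex[t [t0 [t1 ht]]]; exists t => // x.
have [xb|xb] := boolP (x \in `[- b, b]); first exact: ht.
apply: (@le_trans _ _ e%:E); last by rewrite lee_fin lerDr.
apply: le_trans hm; apply: le_measure; rewrite ?inE; [exact: measurable_RV_ball|exact: measurable_RV_tail|].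
move=> w /=; move: xb; rewrite in_itv /= -ler_norml -ltNge /b => xb hw.
have := ler_normD (x - X w) (X w); rewrite subrK distrC; lra.
Unshelve. all: by end_near. Qed.

End random_variable_bounds.

(** * Grid discretisation of the line *)

Section grid.
Context {R : realType} (delta : R) (m : nat).
Hypothesis delta0 : 0 < delta.

(* The last cell [m.*2] collects everything outside the window *)
Definition cell (x : R) : 'I_m.*2.+1 :=
  inord (if `|x| < m%:R * delta then Num.trunc ((x + m%:R * delta) / delta) else m.*2).

Lemma cell_in x : `|x| < m%:R * delta ->
  [/\ (cell x < m.*2)%N, (cell x)%:R * delta <= x + m%:R * delta &
    x + m%:R * delta < ((cell x)%:R + 1) * delta].
Proof.
move=> xm; have := xm; rewrite ltr_norml => /andP[x1 x2].
set z := (x + m%:R * delta) / delta.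
have z0 : 0 <= z by rewrite divr_ge0 ?(ltW delta0)//; lra.
have /andP[t1 t2] := Num.Theory.trunc_itv z0.
have tm : (Num.trunc z < m.*2)%N.
  rewrite -(ltr_nat R); apply: (le_lt_trans t1); rewrite ltr_pdivrMr// -muln2 natrM; lra.
have cE : cell x = Num.trunc z :> nat by rewrite /cell xm inordK// ltnW// ltnS.
by rewrite cE natr1 -ler_pdivlMr// -ltr_pdivrMr//; split.
Qed.

Lemma cell_out x : m%:R * delta <= `|x| -> cell x = ord_max.
Proof. by move=> xm; apply/val_inj; rewrite /cell ltNge xm /= inordK. Qed.

Lemma measurable_cell b : measurable (cell @^-1` [set b] : set R).
Proof.
have [->|bm] := eqVneq b ord_max.
  rewrite (_ : _ @^-1` _ = ~` `](- (m%:R * delta)), (m%:R * delta)[%classic).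
    by apply: measurableC; exact: measurable_itv.
  apply/seteqP; split=> x /=; rewrite in_itv /= -ltr_norml.
    by move=> xb /cell_in[]; rewrite xb ltnn.
  by move=> /negP; rewrite -leNgt; exact: cell_out.
rewrite (_ : _ @^-1` _ = `](- (m%:R * delta)), (m%:R * delta)[%classic `&`
   `[b%:R * delta - m%:R * delta, (b%:R + 1) * delta - m%:R * delta[%classic).
  by apply: measurableI; exact: measurable_itv.
apply/seteqP; split=> x /=; rewrite !in_itv /= -ltr_norml.
  move=> xb; have xm : `|x| < m%:R * delta.
    by rewrite ltNge; apply: contra bm => /cell_out <-; rewrite xb.
  by have [_] := cell_in xm; rewrite xb lerBlDr ltrBrDr => -> ->.
move=> [xm /andP[b1 b2]]; have [_ c1 c2] := cell_in xm; apply/val_inj => /=.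
have h1 : (cell x)%:R < b%:R + 1 :> R by rewrite -(ltr_pM2r delta0); lra.
have h2 : b%:R < (cell x)%:R + 1 :> R by rewrite -(ltr_pM2r delta0); lra.
move: h1 h2; rewrite !natr1 !ltr_nat !ltnS => h1 h2.
by apply/eqP; rewrite eqn_leq h1.
Qed.

(** Left endpoint of the cell. For the overflow cell the value is a mere default, and its mass is
    charged to the tail event. *)
Definition cell_pt (b : 'I_m.*2.+1) : R := (b%:R - m%:R) * delta.

Lemma cell_pt_dist x : `|x| < m%:R * delta -> `|cell_pt (cell x) - x| <= delta.
Proof. by move=> /cell_in[_ c1 c2]; rewrite /cell_pt ler_norml; lra. Qed.

End grid.

(** * Reduction to discrete laws *)

Section reduction.
Context disp (T : measurableType disp) (R : realType) (Pr : probability T R).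
Context (n : nat) (X : 'I_n -> {RV Pr >-> R}) (P : 'M[R]_n) (u : 'cV[R]_n).
Let Z w : 'cV[R]_n := \col_i X i w.

Lemma measurable_norm2_event c : 0 <= c -> measurable [set w | norm2 (P *m Z w - u) <= c].
Proof.
move=> c0; pose g w := dotv (P *m Z w - u) (P *m Z w - u).
have mc i : measurable_fun setT (fun w => (P *m Z w - u) i 0).
  rewrite (_ : (fun w => _) = (fun w => \sum_j P i j * X j w - u i 0)); last first.
    by apply/funext => w; rewrite !mxE; congr (_ - _); apply: eq_bigr => j _; rewrite mxE.
  apply: measurable_funB => //; apply: measurable_sum => j.
  by apply: measurable_funM => //; exact: measurable_funPT.
have mg : measurable_fun setT g.
  by apply: measurable_sum => i; apply: measurable_funM.
rewrite (_ : [set w | _] = setT `&` g @^-1` `]-oo, c ^+ 2]%classic); first exact: mg.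
rewrite setTI; apply/seteqP; split=> w /=; rewrite in_itv /= /norm2 -/(g w).
  move=> gc; rewrite -[g w]sqr_sqrtr ?dotvv_ge0//.
  by rewrite lerXn2r// nnegrE sqrtr_ge0.
move=> gc; rewrite -(ger0_norm c0) -sqrtr_sqr; exact: ler_wsqrtr.
Qed.

Variables (t p e : R) (d : nat).
Hypotheses (indep : mutually_independent X) (t0 : 0 < t) (e0 : 0 < e) (d0 : (0 < d)%N).
Hypothesis hp : forall i x, (Pr [set w | (`|X i w - x| <= t)%R] <= p%:E)%E.
Hypotheses (sP : symidem P) (tP : \tr P = d%:R).

(** Union bound over the tails, which cost [n%:R * e], and over the discrete configurations
    compatible with the event, whose total mass Markov's inequality bounds by the Gaussian sum of
    [sum_gauss_projection]. *)
Lemma probability_projection_le :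
  (Pr [set w | (norm2 (P *m Z w - u) <= t * Num.sqrt d%:R)%R] <=
   ((expR 8 * @core_const R * (p + e)) ^+ d + n%:R * e)%:E)%E.
Proof.
(* Fine enough that rounding all n coordinates moves the vector by a squared distance of at most n
   delta^2 <= t^2 / 4. *)
pose delta := t / (2 * n.+1%:R).
have delta0 : 0 < delta by rewrite divr_gt0// mulr_gt0.
have [M hM] : exists M : nat, forall i, (Pr [set w | (M%:R <= `|X i w|)%R] <= e%:E)%E.
  have /choice[f hf] i := probability_tight (X i) e0.
  exists (\max_i f i)%N => i; apply: le_trans (hf i); apply: le_measure;
    rewrite ?inE; [exact: measurable_RV_tail..|].
  by move=> w /=; apply: le_trans; rewrite ler_nat leq_bigmax.
pose m := (Num.trunc (M%:R / delta)).+1.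
have Mm : M%:R <= m%:R * delta.
  rewrite -ler_pdivrMr//; apply: ltW.
  by have /andP[] := Num.Theory.trunc_itv (divr_ge0 (ler0n R M) (ltW delta0)).
pose k i w := cell delta m (X i w).
have mk i b : measurable [set w | k i w = b].
  exact: (measurable_RV_preimage (X i) (@measurable_cell R delta m delta0 b)).
pose q i b := fine (Pr [set w | k i w = b]).
have qE i b : (q i b)%:E = Pr [set w | k i w = b] by rewrite fineK// fin_num_measure.
have q0 i b : 0 <= q i b by rewrite fine_ge0.
have q1 i : \sum_b q i b = 1.
  apply: EFin_inj; rewrite -sumEFin (eq_bigr _ (fun b _ => qE i b)) sum_probability_fiber//.
  rewrite -[RHS](@probability_setT _ _ _ Pr); congr (Pr _).
  by apply/seteqP; split.
have mout i : measurable [set w | m%:R * delta <= `|X i w|] by exact: measurable_RV_tail.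
have hout i : (Pr [set w | (m%:R * delta <= `|X i w|)%R] <= e%:E)%E.
  apply: le_trans (hM i); apply: le_measure; rewrite ?inE//; first exact: measurable_RV_tail.
  by move=> w /=; exact: le_trans.
(* Unit of length for the discrete law: a unit ball for [y] has radius t / 2 for the cell points,
   and rounding by delta <= t / 2 keeps the original point within t. *)
pose s := t / 2; have s0 : 0 < s by rewrite divr_gt0.
pose y (b : 'I_m.*2.+1) := cell_pt delta b / s.
have dt : delta <= s.
  rewrite /delta /s ler_pM2l// lef_pV2 ?posrE ?mulr_gt0// ler_peMr// ler1n//.
have qp i x : \sum_(b | `|y b - x| <= 1) q i b <= p + e.
  rewrite -lee_fin -sumEFin (eq_bigr _ (fun b _ => qE i b)) sum_probability_fiber//.
  rewrite EFinD; apply: (@le_trans _ _ (Pr ([set w | `|X i w - s * x| <= t] `|` [set w | m%:R * delta <= `|X i w|]))).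
    apply: le_measure; rewrite ?inE.
    - rewrite (_ : [set w | _] = \big[setU/set0]_(b | `|y b - x| <= 1) [set w | k i w = b]).
        by apply: bigsetU_measurable.
      apply/seteqP; split=> w.
        by move=> /= h; apply/mem_bigsetU; exists (k i w).
      by move=> /mem_bigsetU[b [h /= kb]]; rewrite /= kb.
    - by apply: measurableU => //; exact: measurable_RV_ball.
    - move=> w /= h; have [xm|xm] := leP (m%:R * delta) `|X i w|; [by right|left].
      have c1 := cell_pt_dist delta0 xm; rewrite -/(k i w) in c1.
      have c2 : `|cell_pt delta (k i w) - s * x| <= s.
        have -> : cell_pt delta (k i w) - s * x = s * (y (k i w) - x).
          by rewrite mulrBr /y mulrCA mulfV ?mulr1// gt_eqF.
        by rewrite normrM gtr0_norm// ler_piMr// ltW.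
      move: c1 c2; rewrite !ler_norml => /andP[? ?] /andP[? ?].
      have st : s + s = t by rewrite /s; field.
      lra.
  apply: le_trans (measureU2 _ (measurable_RV_ball _ _ _) (mout i)) _.
  exact: leeD (hp i (s * x)) (hout i).
pose Y (f : {ffun 'I_n -> 'I_m.*2.+1}) : 'cV[R]_n := \col_i y (f i).
pose v := s^-1 *: u.
(* On the event, s^2 |P z|^2 <= 2 (t^2 / 4) + 2 t^2 d with s^2 = t^2 / 4, so |P z|^2 <= 2 + 8 d <=
   16 d because d >= 1. *)
pose good f := qform P (Y f - v) <= 16 * d%:R.
pose F (j : 'I_n + {ffun 'I_n -> 'I_m.*2.+1}) := match j with
  | inl i => [set w | m%:R * delta <= `|X i w|]
  | inr f => [set w | forall i, k i w = f i]
  end.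
pose Q (f : {ffun 'I_n -> 'I_m.*2.+1}) := \prod_i q i (f i).
have PrF (f : {ffun 'I_n -> 'I_m.*2.+1}) : Pr [set w | forall i, k i w = f i] = (Q f)%:E.
  have := indep (J := [set: 'I_n]%SET) (A := fun i => cell delta m @^-1` [set f i]).
  move=> /(_ (fun i _ => @measurable_cell R delta m delta0 (f i))) H.
  rewrite /Q -prodEFin; transitivity (Pr [set w | forall i, i \in [set: 'I_n]%SET -> (cell delta m @^-1` [set f i]) (X i w)]).
    congr (Pr _); apply/seteqP; split=> w /= h i; first by move=> _; exact: h.
    by apply: h; rewrite inE.
  rewrite H; apply: eq_big => [i|i _]; first by rewrite inE.
  by rewrite qE.
have mF j : measurable (F j).
  case: j => [i|f] /=; first exact: mout.
  rewrite (_ : [set w | _] = \bigcap_(i in [set: 'I_n]) [set w | k i w = f i]).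
    by apply: fin_bigcap_measurable.
  by apply/seteqP; split=> w /= h i; [move=> _|]; exact: h.
pose PF (j : 'I_n + {ffun 'I_n -> 'I_m.*2.+1}) := if j is inr f then good f else true.
have cover w : norm2 (P *m Z w - u) <= t * Num.sqrt d%:R -> exists j, PF j /\ F j w.
  move=> hw; have [/existsP[i hi]|/existsPn hin] := boolP [exists i, m%:R * delta <= `|X i w|].
    by exists (inl i).
  exists (inr [ffun i => k i w]); split; last by move=> i; rewrite ffunE.
  rewrite /= /good; set z := Y _ - v.
  have sz : s *: z = (s *: Y [ffun i => k i w] - Z w) + (Z w - u).
    by rewrite subrKA scalerBr scalerA mulfV ?gt_eqF// scale1r.
  have Es : qform P (s *: z) = s ^+ 2 * qform P z.
    by rewrite /qform -scalemxAr [(s *: z)^T]linearZ /= -!scalemxAl scalerA [LHS]mxE expr2.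
  have h1 : qform P (s *: Y [ffun i => k i w] - Z w) <= t ^+ 2 / 4.
    apply: le_trans (qform_le _ sP) _.
    apply: (@le_trans _ _ (\sum_(i < n) delta ^+ 2)).
      apply: ler_sum => i _; rewrite -expr2 -real_normK ?num_real//.
      rewrite lerXn2r ?nnegrE// ?(ltW delta0)// !mxE ffunE /y mulrCA mulfV ?gt_eqF// mulr1.
      by apply: cell_pt_dist; rewrite // ltNge.
    rewrite sumr_const card_ord /delta.
    rewrite (_ : _ *+ n = t ^+ 2 / 4 * (n%:R / n.+1%:R ^+ 2)); last first.
      rewrite -[LHS]mulr_natl; have : n.+1%:R != 0 :> R by rewrite pnatr_eq0.
      by move: (n.+1%:R : R) => N N0; field.
    rewrite ler_piMr// ?divr_ge0 ?sqr_ge0//.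
    rewrite ler_pdivrMr ?exprn_gt0// mul1r -natrX ler_nat.
    by apply: leq_trans (leqnSn n) _; rewrite expnS leq_pmulr.
  have h2 : qform P (Z w - u) <= t ^+ 2 * d%:R.
    have -> : qform P (Z w - u) = qform P (P *m Z w - u).
      by rewrite !qform_dotv// !mulmxBr mulmxA sP.2.
    apply: le_trans (qform_le _ sP) _.
    rewrite -[leLHS]sqr_sqrtr ?dotvv_ge0// -[d%:R]sqr_sqrtr// -exprMn.
    by rewrite lerXn2r// nnegrE ?mulr_ge0 ?sqrtr_ge0// ltW.
  have := qformD_le (s *: Y [ffun i => k i w] - Z w) (Z w - u) sP; rewrite -sz Es => h3.
  have d1 : 1 <= d%:R :> R by rewrite ler1n.
  have ss : s ^+ 2 = t ^+ 2 / 4 by rewrite /s; field.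
  have s20 : 0 < s ^+ 2 by rewrite exprn_gt0.
  rewrite -(ler_pM2l s20).
  have t20 : 0 <= t ^+ 2 by rewrite sqr_ge0.
  rewrite ss in h3 *; move: h1 h2 h3; nra.
have mev : measurable [set w | norm2 (P *m Z w - u) <= t * Num.sqrt d%:R].
  by apply: measurable_norm2_event; rewrite mulr_ge0 ?sqrtr_ge0// ltW.
apply: (le_trans (@probability_le_sum _ _ _ Pr _ PF _ F mev mF cover)).
rewrite big_sumType /= addeC EFinD; apply: leeD; last first.
  apply: (@le_trans _ _ (\sum_(i < n) e%:E)%E); first exact: lee_sum.
  by rewrite sumEFin lee_fin sumr_const card_ord mulr_natl.
rewrite (eq_bigr _ (fun f _ => PrF f)) sumEFin lee_fin.
have Q0 f : 0 <= Q f by apply: prodr_ge0.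
rewrite -mulrA exprMn -expRM_natl.
apply: le_trans (ler_wpM2l (expR_ge0 _) (sum_gauss_projection q0 q1 qp v sP tP)).
rewrite mulr_sumr big_mkcond; apply: ler_sum => f _.
case: ifPn => gf; last by rewrite !mulr_ge0 ?expR_ge0// Q0.
(* Markov's inequality: on [good] the exponent 8 d - |P z|^2 / 2 is nonnegative. *)
rewrite mulrCA -expRD ler_peMr// ?Q0// -[leLHS]expR0 ler_expR.
by move: gf; rewrite /good; lra.
Qed.

End reduction.

Lemma norm2_scalar (R : realType) (a : R) : norm2 (a%:M : 'cV[R]_1) = `|a|.
Proof. by rewrite /norm2 /dotv big_ord1 !mxE mulr1n -expr2 sqrtr_sqr. Qed.

Lemma concentration_scalar_le disp (T : measurableType disp) (R : realType)
    (Pr : probability T R) (X : T -> R) (t p : R) (x : R) :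
  (concentration Pr (fun w => (X w)%:M : 'cV[R]_1) t <= p%:E)%E ->
  (Pr [set w | (`|X w - x| <= t)%R] <= p%:E)%E.
Proof.
apply: le_trans; apply: ereal_sup_ubound; exists x%:M => //.
congr (Pr _); apply/seteqP.
by split=> w /=; rewrite -(raddfB (scalar_mx (n := 1))) /= norm2_scalar.
Qed.

(** The discretisation divides by the radius, so t = 0 is replaced by a positive radius common to
    all coordinates, at the price of [e]. The neutral value 1 of the minimum covers n = 0. *)
Lemma uniform_radius disp (T : measurableType disp) (R : realType)
    (Pr : probability T R) n (X : 'I_n -> {RV Pr >-> R}) (t p e : R) :
  0 <= t -> 0 <= p -> 0 < e ->
  (forall i x, Pr [set w | (`|X i w - x| <= t)%R] <= p%:E)%E ->
  exists t', [/\ 0 < t', t <= t' &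
    forall i x, (Pr [set w | (`|X i w - x| <= t')%R] <= (p + e)%:E)%E].
Proof.
move=> t0 p0 e0; have [->|tn0] := eqVneq t 0 => hp; last first.
  exists t; split=> //; first by rewrite lt_neqAle eq_sym tn0.
  by move=> i x; apply: le_trans (hp i x) _; rewrite lee_fin lerDl ltW.
have /choice[r hr] i : exists r, 0 < r /\
    forall x, (Pr [set w | (`|X i w - x| <= r)%R] <= (p + e)%:E)%E.
  by have [r r0 h] := probability_uniform_small_ball p0 (hp i) e0; exists r.
have m0 : 0 < \big[Order.min/1]_i r i.
  by elim/big_ind: _ => // [a b a0 b0|i _]; [rewrite lt_min a0|have [] := hr i].
exists (\big[Order.min/1]_i r i); split=> // [|i x]; first exact: ltW.
have [_ /(_ x)] := hr i; apply: le_trans; apply: le_measure;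
  rewrite ?inE; [exact: measurable_RV_ball..|].
move=> w /= h; apply: le_trans h _; exact: bigmin_le_cond.
Qed.

(* Lets the error of the discretisation tend to [0]. *)
Lemma le_poly_error_lim (R : realType) (x c p : R) d n :
  (forall e, 0 < e -> x <= (c * (p + 2 * e)) ^+ d + n%:R * e) -> x <= (c * p) ^+ d.
Proof.
move=> h; pose f : {poly R} := (c%:P * (p%:P + 2%:P * 'X)) ^+ d + n%:R%:P * 'X.
have fE e : f.[e] = (c * (p + 2 * e)) ^+ d + n%:R * e by rewrite /f !hornerE.
have : f.[e] @[e --> 0^'+] --> f.[0] by apply: cvg_at_right_filter; exact: continuous_horner.
rewrite fE !mulr0 !addr0 => fl; rewrite -(cvg_lim _ fl)//.
apply: limr_ge; first by apply/cvg_ex; eexists; exact: fl.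
by near=> e; rewrite fE; apply: h; near: e; exact: nbhs_right_gt.
Unshelve. all: by end_near. Qed.

Theorem corollary1p4 (R : realType) :
  exists C : R, 0 < C /\
    forall (disp : measure_display) (T : measurableType disp)
      (Pr : probability T R) (n : nat) (X : 'I_n -> {RV Pr >-> R}) (t p : R)
      (d : nat) (E : {vspace 'cV[R]_n}) (P : 'M[R]_n),
      mutually_independent X ->
      0 <= t -> 0 <= p ->
      (forall i : 'I_n,
         (concentration Pr (fun w => (X i w)%:M : 'cV[R]_1) t <= p%:E)%E) ->
      \dim E = d ->
      is_orthogonal_projection P E ->
      (concentration Pr (fun w => P *m \col_(i < n) X i w)
         (t * Num.sqrt d%:R) <= ((C * p) ^+ d)%:E)%E.
Proof.
exists (expR 8 * core_const); split; first by rewrite mulr_gt0 ?expR_gt0 ?core_const_gt0.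
move=> disp T Pr n X t p d E P indep t0 p0 hX dE PE.
apply: ge_ereal_sup => _ [u _ <-].
have td : 0 <= t * Num.sqrt (d%:R : R) by rewrite mulr_ge0 ?sqrtr_ge0.
have mA := measurable_norm2_event X P u td.
(* For d = 0 the bound is 1; the reduction itself requires d >= 1. *)
have [d0|d0] := posnP d.
  by rewrite {2}d0 expr0; exact: probability_le1.
have hp i x := concentration_scalar_le x (hX i).
have sP := orthogonal_projection_symidem PE.
have tP := orthogonal_projection_tr PE; rewrite dE in tP.
rewrite -[X in (X <= _)%E]fineK ?fin_num_measure// lee_fin.
(* Of the excess 2 e over [p], one e pays for the positive radius and the other for the mass lost in
   the tails. *)
apply: (@le_poly_error_lim _ _ _ _ d n) => e e0.
have [t' [t'0 tt' hp']] := uniform_radius t0 p0 e0 hp.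
have := probability_projection_le u indep t'0 e0 d0 hp' sP tP.
rewrite -addrA -[e + e](mulr_natl e 2) -lee_fin fineK ?fin_num_measure//; apply: le_trans.
apply: le_measure; rewrite ?inE//.
  by apply: measurable_norm2_event; rewrite mulr_ge0 ?sqrtr_ge0// ltW.
by move=> w /= /le_trans; apply; rewrite ler_wpM2r ?sqrtr_ge0.
Qed.
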